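(* Every element $f\in 2V$ gives rise to a unique prefix word in the letters $A_i,B_j,C_k$ arising from its reduced grid tree-pair diagram as follows. Suppose the source grid of the reduced grid diagram of $f$ gives rise to a vertical tree $T_v$ with $n+1$ leaves and a horizontal tree $T_h$ with $m+1$ leaves. Then: (1) $T_v$ corresponds to a word $A_0^{a_0}A_1^{a_1}\cdots A_n^{a_n}$. (2) $T_h$ corresponds to two words depending on where in $T_v$ it hangs: $B_0^{b_0}B_1^{b_1}\cdots B_m^{b_m}$ when it is on the spine (where $b_p$ can be zero), and $B_0^{b'_0}B_1^{b'_1}\cdots B_m^{b'_m}$ when it is not on the spine (that is, when it hangs from the interior or left side of the tree); each exponent $b'_p$ is equal to either $b_p$ or $b_p+1$. (3) The full tree corresponding to the source grid (a copy of $T_h$ hanging from each leaf of $T_v$) admits a unique word, made out of the concatenation, in this order, of the following words: - a word of the type $C_iC_{i+1}\cdots C_{i+\ell}$ corresponding to the horizontal carets on the spine of $T_h$, where the indices are all consecutive; - the $n$ words $$A_{(m+1)j}^{a_j}B_{(m+1)j}^{b'_0}B_{(m+1)j+1}^{b'_1}\cdots B_{(m+1)j+m}^{b'_m},\qquad j=0,1,\ldots,n-1;$$ - a final word $$A_{(m+1)n}^{a_n}B_{(m+1)n}^{b_0}B_{(m+1)n+1}^{b_1}\cdots B_{(m+1)n+m}^{b_m}.$$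
   Context: The group $2V$. A basic dyadic interval is $\left[\frac{i-1}{2^k},\frac{i}{2^k}\right]$ with $k\ge 0$, $1\le i\le 2^k$; a basic dyadic rectangle is a product of two of these. (To obtain honest bijections, intervals may be taken half-open and the unit square to be $[0,1)^2$.) A dyadic subdivision of the unit square is a partition into basic dyadic rectangles obtained by repeatedly halving rectangles vertically (left/right halves) or horizontally (top/bottom halves). It is encoded by a finite rooted binary tree with two types of carets: a triangular (vertical-type) caret for a halving into left and right halves (left child = left half) and a square (horizontal-type) caret for a halving into top and bottom halves (left child = top half). Leaves of a tree are numbered from left to right starting with $0$. $2V$ is the group of bijections $f$ of the unit square for which there are two dyadic subdivisions (source and target) with the same number of rectangles and a bijection between their rectangles such that $f$ maps each source rectangle onto the corresponding target rectangle by an affine map $(x,y)\mapsto(2^{p}x+c,2^{q}y+d)$, $p,q\in\mathbb{Z}$. ''Affine on a rectangle'' means being a single map of this form there. Words in elements of $2V$ are composed from left to right (in $gh$, the map $g$ is applied first). Reduced grid diagram. A grid diagram of $f$ is given by a binary tree $T_v$ with only triangular carets, whose leaves are the intervals $I_0,\dots,I_n$ of a subdivision of the bottom edge $[0,1]$ by iterated halving, and a binary tree $T_h$ with only square carets, whose leaves are the intervals $J_0,\dots,J_m$ of a subdivision of the left edge $[0,1]$ by iterated halving (listed from top to bottom), such that $f$ is affine on each $I_i\times J_j$ with image a basic dyadic rectangle. It is reduced if for every exposed caret of $T_v$ (interior node both of whose children are leaves), with leaves $I_i,I_{i+1}$, there is a $j$ such that $f$ is not affine on $(I_i\cup I_{i+1})\times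 J_j$ or the image of this rectangle is not a basic dyadic rectangle, and the analogous condition with the coordinates exchanged holds for every exposed caret of $T_h$. Every $f\in 2V$ has a unique reduced grid diagram. The full tree corresponding to the source grid is the tree obtained by hanging a copy of $T_h$ from each leaf of $T_v$; it has $(n+1)(m+1)$ leaves. Generators. Let $R_k$ be the all-right tree with $k$ carets, all triangular (each caret after the root is attached to the right leaf of the previous one). For $i\ge 0$: $A_i$ (respectively $B_i$) is the element of $2V$ with source tree $R_{i+1}$ with a triangular (respectively square) caret attached at leaf $i$, and target tree $R_{i+2}$, leaves being matched in left-to-right order. $C_i$ has source tree the all-right tree with $i+1$ carets whose last caret is square and whose other carets are triangular, and target tree $R_{i+1}$, leaves being matched in left-to-right order. Words corresponding to trees. The (right) spine of a tree is the set of carets on the path of right edges from the root to the last leaf. A word in the letters $A_i,B_j,C_k$ corresponds to a tree $T$ with $N+1$ leaves if it represents the element with source tree $T$ and target tree $R_N$, leaves being matched in left-to-right order. The exponents are given by the leaf exponent method: - $a_j\ge 0$ is the length of the maximal path of left edges going up from leaf $j$ of $T_v$ that does not reach the right spine of $T_v$ (so a left edge whose upper endpoint is a spine caret is not counted). - $b_p\ge0$ is the same quantity for leaf $p$ of $T_h$, so that $B_0^{b_0}\cdots B_m^{b_m}$ accounts for the carets of $T_h$ not on its spine. - $b'_p\ge 0$ is the length of the maximal path of left edges going up from leaf $p$ within $T_h$, left edges whose upper endpoint is a spine caret of $T_h$ now being counted (so that all carets of $T_h$ are accounted for). A copy of $T_h$ is on the spine if it hangs from the last leaf of $T_v$, and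 is not on the spine if it hangs from any other leaf of $T_v$. In the word $C_iC_{i+1}\cdots C_{i+\ell}$, the smallest index $i$ is the number of carets on the spine of $T_v$, and $\ell+1$ is the number of carets on the spine of $T_h$ (the word is empty if $T_h$ has no carets). Uniqueness means that the word is determined by $f$, through the trees $T_v,T_h$ of its unique reduced grid diagram. *)

(* Defs.v *)
From mathcomp Require Import all_boot all_order all_algebra.
From mathcomp Require Import boolp classical_sets functions reals.

Set Implicit Arguments.
Unset Strict Implicit.
Unset Printing Implicit Defensive.

Import Order.TTheory GRing.Theory Num.Theory.
Local Open Scope classical_set_scope.
Local Open Scope ring_scope.

(* The pair (k, i) stands for [i/2^k, (i+1)/2^k); it is a basic dyadic
   interval when i < 2^k, so indices start at 0. *)
Definition dyadic : Type := nat * nat.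
Definition drect : Type := dyadic * dyadic.

Definition unit_rect : drect := ((0, 0), (0, 0))%N.
Definition lo_half (d : dyadic) : dyadic := (d.1.+1, d.2.*2).
Definition hi_half (d : dyadic) : dyadic := (d.1.+1, d.2.*2.+1).

Inductive shape := Tri | Sq.

(* Tri halves into left and right, Sq into top and bottom; the left child is
   the left half, respectively the top half. *)
Inductive tree := Leaf | Node of shape & tree & tree.

Fixpoint all_shape (is_shape : shape -> Prop) (t : tree) : Prop :=
  if t is Node c l r then
    [/\ is_shape c, all_shape is_shape l & all_shape is_shape r]
  else True.

Definition only_tri : tree -> Prop := all_shape (fun c => c = Tri).
Definition only_sq : tree -> Prop := all_shape (fun c => c = Sq).

Fixpoint leaves_from (r : drect) (t : tree) : seq drect :=
  match t with
  | Leaf => [:: r]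
  | Node Tri t1 t2 =>
      leaves_from (lo_half r.1, r.2) t1 ++ leaves_from (hi_half r.1, r.2) t2
  | Node Sq t1 t2 =>
      leaves_from (r.1, hi_half r.2) t1 ++ leaves_from (r.1, lo_half r.2) t2
  end.

Definition leaves (t : tree) : seq drect := leaves_from unit_rect t.
Definition nleaves (t : tree) : nat := size (leaves t).
Definition leaf_rect (t : tree) (i : nat) : drect := nth unit_rect (leaves t) i.

(* Paths from the root to the leaves, leaves being listed from left to right;
   a left edge is false and a right edge is true. *)
Fixpoint leaf_paths (t : tree) : seq (seq bool) :=
  if t is Node _ t1 t2 then
    [seq false :: p | p <- leaf_paths t1] ++ [seq true :: p | p <- leaf_paths t2]
  else [:: [::]].

Definition leaf_path (t : tree) (i : nat) : seq bool :=
  nth [::] (leaf_paths t) i.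

(* Some interior node has leaves i and i+1 as its two children. *)
Definition exposed (t : tree) (i : nat) : Prop :=
  exists q : seq bool,
    leaf_path t i = rcons q false /\ leaf_path t i.+1 = rcons q true.

Definition left_run (p : seq bool) : nat := find id (rev p).

(* All left edges going up from leaf i: the exponents b'. *)
Definition full_leaf_exponent (t : tree) (i : nat) : nat :=
  left_run (leaf_path t i).

(* The same left edges, except those whose upper endpoint take k p is a spine
   caret, i.e., is reached from the root by right edges only: the exponents
   a and b. *)
Definition leaf_exponent (t : tree) (i : nat) : nat :=
  let p := leaf_path t i in
  count (fun k => ~~ all id (take k p))
        (iota (size p - left_run p) (left_run p)).

Fixpoint spine_size (t : tree) : nat :=
  if t is Node _ _ t2 then (spine_size t2).+1 else 0%N.

Fixpoint right_tree (k : nat) : tree :=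
  if k is k'.+1 then Node Tri Leaf (right_tree k') else Leaf.

(* s with t hung from its leaf number k *)
Fixpoint graft (s : tree) (k : nat) (t : tree) : tree :=
  match s with
  | Leaf => if k == 0%N then t else Leaf
  | Node c s1 s2 =>
      if (k < nleaves s1)%N then Node c (graft s1 k t) s2
      else Node c s1 (graft s2 (k - nleaves s1) t)
  end.

(* s with a copy of t hung from each leaf *)
Fixpoint hang (s t : tree) : tree :=
  if s is Node c s1 s2 then Node c (hang s1 t) (hang s2 t) else t.

(* t with its spine carets made triangular *)
Fixpoint tri_spine (t : tree) : tree :=
  if t is Node _ t1 t2 then Node Tri t1 (tri_spine t2) else Leaf.

Section Plane.
Variable R : realType.
Implicit Types (f : R * R -> R * R) (D : set (R * R)) (z : R * R).

Definition interval_of (d : dyadic) : set R :=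
  [set x : R | d.2%:R / 2 ^+ d.1 <= x < d.2.+1%:R / 2 ^+ d.1].

Definition rect_of (r : drect) : set (R * R) :=
  interval_of r.1 `*` interval_of r.2.

Definition unit_square : set (R * R) :=
  [set z | (0 <= z.1 < 1) && (0 <= z.2 < 1)].

Definition basic_dyadic_rect D : Prop :=
  exists r : drect,
    [/\ (r.1.2 < 2 ^ r.1.1)%N, (r.2.2 < 2 ^ r.2.1)%N & D = rect_of r].

Definition affine_on f D : Prop :=
  exists (p q : int) (c d : R),
    forall z, D z -> f z = (2 ^ p * z.1 + c, 2 ^ q * z.2 + d).

(* The elements of 2V. The list ts is the target subdivision, enumerated
   so that f maps the i-th source rectangle onto the i-th member of ts. Only
   the values of f on the unit square are relevant. *)
Definition in_2V f : Prop :=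
  set_bij unit_square unit_square f /\
  exists (S T : tree) (ts : seq drect),
    [/\ perm_eq ts (leaves T), size ts = nleaves S &
        forall i, (i < nleaves S)%N ->
          affine_on f (rect_of (leaf_rect S i)) /\
          f @` rect_of (leaf_rect S i) = rect_of (nth unit_rect ts i)].

Definition affine_to_basic f D : Prop :=
  affine_on f D /\ basic_dyadic_rect (f @` D).

(* I_i and J_j; as the first leaf of a square caret is the top half, the J_j
   are listed from top to bottom. *)
Definition vinterval (Tv : tree) (i : nat) : set R :=
  interval_of (leaf_rect Tv i).1.
Definition hinterval (Th : tree) (j : nat) : set R :=
  interval_of (leaf_rect Th j).2.

Definition grid_diagram f (Tv Th : tree) : Prop :=
  [/\ only_tri Tv, only_sq Th &
      forall i j, (i < nleaves Tv)%N -> (j < nleaves Th)%N ->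
        affine_to_basic f (vinterval Tv i `*` hinterval Th j)].

Definition reduced_grid_diagram f (Tv Th : tree) : Prop :=
  [/\ grid_diagram f Tv Th,
      forall i, exposed Tv i ->
        exists2 j, (j < nleaves Th)%N &
          ~ affine_to_basic f
              ((vinterval Tv i `|` vinterval Tv i.+1) `*` hinterval Th j) &
      forall j, exposed Th j ->
        exists2 i, (i < nleaves Tv)%N &
          ~ affine_to_basic f
              (vinterval Tv i `*` (hinterval Th j `|` hinterval Th j.+1))].

(* the increasing affine map of interval_of d onto interval_of e *)
Definition dyadic_map (d e : dyadic) (x : R) : R :=
  (x - d.2%:R / 2 ^+ d.1) * (2 ^+ d.1 / 2 ^+ e.1) + e.2%:R / 2 ^+ e.1.

Definition in_rect (r : drect) z : bool := `[< rect_of r z >].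

(* The map with source tree S and target tree T, leaves being matched in
   left-to-right order (for nleaves S = nleaves T). Outside the unit square
   the index k is out of range and the map is the identity. *)
Definition tree_pair_map (S T : tree) z : R * R :=
  let k := find (fun r => in_rect r z) (leaves S) in
  let s := leaf_rect S k in
  let t := leaf_rect T k in
  (dyadic_map s.1 t.1 z.1, dyadic_map s.2 t.2 z.2).

End Plane.

Inductive letter := A_ of nat | B_ of nat | C_ of nat.
Definition word : Type := seq letter.

Definition letter_map (R : realType) (x : letter) : R * R -> R * R :=
  match x with
  | A_ i => tree_pair_map (graft (right_tree i.+1) i (Node Tri Leaf Leaf))
                          (right_tree i.+2)
  | B_ i => tree_pair_map (graft (right_tree i.+1) i (Node Sq Leaf Leaf))
                          (right_tree i.+2)
  | C_ i => tree_pair_map (graft (right_tree i) i (Node Sq Leaf Leaf))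
                          (right_tree i.+1)
  end.

(* Words are composed from left to right. *)
Fixpoint word_map (R : realType) (w : word) (z : R * R) : R * R :=
  if w is x :: w' then word_map w' (letter_map x z) else z.

Definition corresponds (R : realType) (w : word) (T : tree) : Prop :=
  forall z : R * R, unit_square z ->
    word_map w z = tree_pair_map T (right_tree (nleaves T).-1) z.

(* A_0^(e 0) ... A_n^(e n) *)
Definition A_word (e : nat -> nat) (n : nat) : word :=
  flatten [seq nseq (e p) (A_ p) | p <- iota 0 n.+1].

(* B_k^(e 0) B_(k+1)^(e 1) ... B_(k+m)^(e m) *)
Definition B_word (k : nat) (e : nat -> nat) (m : nat) : word :=
  flatten [seq nseq (e p) (B_ (k + p)) | p <- iota 0 m.+1].

(* len letters with consecutive indices, starting with C_i *)
Definition C_word (i len : nat) : word := [seq C_ k | k <- iota i len].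

Definition grid_word (Tv Th : tree) : word :=
  let n := (nleaves Tv).-1 in
  let m := (nleaves Th).-1 in
  let a := leaf_exponent Tv in
  let b := leaf_exponent Th in
  let b' := full_leaf_exponent Th in
  C_word (spine_size Tv) (spine_size Th)
  ++ flatten [seq nseq (a j) (A_ (m.+1 * j)) ++ B_word (m.+1 * j) b' m
             | j <- iota 0 n]
  ++ nseq (a n) (A_ (m.+1 * n)) ++ B_word (m.+1 * n) b m.

(* Main.v *)
Require Import Defs.
From mathcomp Require Import all_boot all_order all_algebra.
From mathcomp Require Import boolp classical_sets functions reals.
From mathcomp Require Import ring lra zify.

Set Implicit Arguments.
Unset Strict Implicit.
Unset Printing Implicit Defensive.

Import Order.TTheory GRing.Theory Num.Theory.

(* Each letter is the effect of adding one caret: if w maps a subdivision with N+1 rectangles onto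
   R_N, leaves in order, then adding a caret at leaf i < N appends A_i or B_i, while at the last
   leaf a triangular caret appends nothing and a square one appends C_N.  So every tree is
   represented by the word that first builds its spine and then its other carets in preorder;
   grouping the latter by the leaf at the bottom of their left path gives the leaf exponents.

   For the grid diagram: f is affine on a rectangle r with basic image s iff f is the increasing
   affine map of r onto s, so this property passes to halves, and it holds on I x J as soon as it
   holds on the four halves of I x J, which overlap pairwise across the two directions.  Hence the
   leafwise intersection of two grid diagrams is a grid diagram, and a reduced one equals its
   intersection with any other, which gives uniqueness.  A uniform grid finer than the source
   subdivision is a grid diagram, and removing carets makes it reduced. *)

(** * Maps between lists of dyadic rectangles *)

Section DyadicGeometry.
Local Open Scope classical_set_scope.
Local Open Scope ring_scope.
Variable R : realType.
Implicit Types (d e : dyadic) (r s : drect) (t : tree) (x : R) (z : R * R)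
  (g h : R * R -> R * R) (L M : seq drect).

Definition width d : R := (2 ^+ d.1)^-1.
Definition lower d : R := d.2%:R / 2 ^+ d.1.

Lemma width_gt0 d : 0 < width d.
Proof. by rewrite invr_gt0 exprn_gt0 // ltr0n. Qed.

Lemma width_half d :
  (width (lo_half d) = width d / 2) * (width (hi_half d) = width d / 2).
Proof. by rewrite /width /= exprSr invfM. Qed.

Lemma lower_lo_half d : lower (lo_half d) = lower d.
Proof.
rewrite /lower /= -muln2 natrM exprSr invfM mulrA mulrAC mulfK //.
by rewrite pnatr_eq0.
Qed.

Lemma lower_hi_half d : lower (hi_half d) = lower d + width d / 2.
Proof.
have := lower_lo_half d; rewrite /lower /width /= -(addn1 d.2.*2) natrD mulrDl => ->.
by rewrite exprSr invfM mul1r.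
Qed.

Lemma interval_ofE d x : interval_of d x = (lower d <= x < lower d + width d).
Proof.
by rewrite /interval_of /= /lower /width -(addn1 d.2) natrD mulrDl mul1r.
Qed.

Lemma dyadic_mapE d e x :
  dyadic_map d e x = (x - lower d) * (width e / width d) + lower e.
Proof. by rewrite /dyadic_map /width invrK [X in _ * X + _]mulrC. Qed.

(** Halving source and target together keeps the affine formula, for every [x]. This is what lets
    two subdivisions be refined in parallel. *)
Lemma dyadic_map_lo d e x : dyadic_map (lo_half d) (lo_half e) x = dyadic_map d e x.
Proof.
have dn0 := lt0r_neq0 (width_gt0 d); have en0 := lt0r_neq0 (width_gt0 e).
rewrite !dyadic_mapE !lower_lo_half !width_half.
by field.
Qed.

Lemma dyadic_map_hi d e x : dyadic_map (hi_half d) (hi_half e) x = dyadic_map d e x.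
Proof.
have dn0 := lt0r_neq0 (width_gt0 d); have en0 := lt0r_neq0 (width_gt0 e).
rewrite !dyadic_mapE !lower_hi_half !width_half.
by field.
Qed.

Lemma dyadic_map_comp d e d' x :
  dyadic_map e d' (dyadic_map d e x) = dyadic_map d d' x.
Proof.
have dn0 := lt0r_neq0 (width_gt0 d); have en0 := lt0r_neq0 (width_gt0 e).
rewrite !dyadic_mapE.
by field; rewrite dn0 en0.
Qed.

Lemma dyadic_map_interval d e x :
  interval_of d x -> interval_of e (dyadic_map d e x).
Proof.
rewrite !interval_ofE dyadic_mapE => /andP[lx xu].
have d0 := width_gt0 d; have e0 := width_gt0 e.
have q0 : 0 < width e / width d by rewrite divr_gt0.
have hd : width d * (width e / width d) = width e.
  by rewrite mulrCA divff ?mulr1 // lt0r_neq0.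
apply/andP; split; first by rewrite lerDr mulr_ge0 ?subr_ge0 // ltW.
by rewrite addrC ltrD2l -[ltRHS]hd ltr_pM2r // ltrBlDl.
Qed.

Lemma interval_halves d x :
  interval_of d x <-> interval_of (lo_half d) x \/ interval_of (hi_half d) x.
Proof.
rewrite !interval_ofE lower_lo_half lower_hi_half !width_half.
have d0 := width_gt0 d.
split=> [/andP[h1 h2]|].
  have [h|h] := ltP x (lower d + width d / 2); [left|right]; apply/andP; lra.
by move=> [] /andP[h1 h2]; apply/andP; lra.
Qed.

Lemma interval_halves_disjoint d x :
  interval_of (lo_half d) x -> interval_of (hi_half d) x -> False.
Proof.
rewrite !interval_ofE lower_lo_half lower_hi_half !width_half.
move=> /andP[h1 h2] /andP[h3 h4]; lra.
Qed.

Definition child1 (c : Defs.shape) r : drect :=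
  if c is Tri then (lo_half r.1, r.2) else (r.1, hi_half r.2).
Definition child2 (c : Defs.shape) r : drect :=
  if c is Tri then (hi_half r.1, r.2) else (r.1, lo_half r.2).

Lemma leaves_from_Node r c t1 t2 :
  leaves_from r (Node c t1 t2)
  = leaves_from (child1 c r) t1 ++ leaves_from (child2 c r) t2.
Proof. by case: c. Qed.

Lemma size_leaves_from r t : size (leaves_from r t) = nleaves t.
Proof.
rewrite /nleaves /leaves; move: unit_rect => r'.
elim: t r r' => [|c t1 IH1 t2 IH2] r r' //.
by rewrite !leaves_from_Node !size_cat (IH1 _ (child1 c r')) (IH2 _ (child2 c r')).
Qed.

Lemma nleaves_Node c t1 t2 : nleaves (Node c t1 t2) = (nleaves t1 + nleaves t2)%N.
Proof. by rewrite {1}/nleaves /leaves leaves_from_Node size_cat !size_leaves_from. Qed.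

Lemma nleaves_gt0 t : (0 < nleaves t)%N.
Proof. by elim: t => [|c t1 IH1 t2 IH2] //; rewrite nleaves_Node addn_gt0 IH1. Qed.

Lemma in_rectP r z : reflect (interval_of r.1 z.1 /\ interval_of r.2 z.2) (in_rect r z).
Proof. by apply: (iffP (asboolP _)). Qed.

(** Adding truth values puts covering by the two halves and their disjointness into one equation. *)
Lemma in_rect_children c r z :
  (in_rect (child1 c r) z + in_rect (child2 c r) z)%N = in_rect r z.
Proof.
have [h1|h1] := in_rectP (child1 c r); have [h2|h2] := in_rectP (child2 c r);
  have [h|h] := in_rectP r => //; exfalso;
  case: c h1 h2 => /=; have := interval_halves r.1 z.1;
  have := interval_halves r.2 z.2;
  have := @interval_halves_disjoint r.1 z.1;
  have := @interval_halves_disjoint r.2 z.2; tauto.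
Qed.

Lemma count_leaves r t z : count (fun s => in_rect s z) (leaves_from r t) = in_rect r z.
Proof.
elim: t r => [|c t1 IH1 t2 IH2] r /=; first by rewrite addn0.
by rewrite -/(leaves_from r (Node c t1 t2)) leaves_from_Node count_cat IH1 IH2 in_rect_children.
Qed.

Definition rect_map r s z : R * R := (dyadic_map r.1 s.1 z.1, dyadic_map r.2 s.2 z.2).

(** Stated for lists rather than trees, so that one rectangle in the middle can be replaced by its
    refinement. *)
Fixpoint maps_rects g L M : Prop :=
  match L, M with
  | r :: L', s :: M' =>
      (forall z, rect_of r z -> g z = rect_map r s z) /\ maps_rects g L' M'
  | [::], [::] => True
  | _, _ => False
  end.

Lemma maps_rects_cat g L1 L2 M1 M2 : size L1 = size M1 ->
  maps_rects g (L1 ++ L2) (M1 ++ M2) <-> maps_rects g L1 M1 /\ maps_rects g L2 M2.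
Proof.
elim: L1 M1 => [|r L1 IH] [|s M1] //= => [_|[eqs]]; first by tauto.
by have := IH _ eqs; tauto.
Qed.

Lemma maps_rects_nth g L M : size L = size M ->
  (forall k z, (k < size L)%N -> rect_of (nth unit_rect L k) z ->
     g z = rect_map (nth unit_rect L k) (nth unit_rect M k) z) ->
  maps_rects g L M.
Proof.
elim: L M => [|r L IH] [|s M] //= [eqs] hk; split=> [z|]; first exact: (hk 0).
by apply: IH => // k z ltk; apply: (hk k.+1).
Qed.

Lemma nth_maps_rects g L M k z : maps_rects g L M ->
  (k < size L)%N -> rect_of (nth unit_rect L k) z ->
  g z = rect_map (nth unit_rect L k) (nth unit_rect M k) z.
Proof.
elim: L M k => [|r L IH] [|s M] //= [|k] [hr hL] //=; first by move=> _; apply: hr.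
exact: IH.
Qed.

Lemma maps_rects_comp g h L M N :
  maps_rects g L M -> maps_rects h M N -> maps_rects (h \o g) L N.
Proof.
elim: L M N => [|r L IH] [|s M] [|q N] //= [hr hL] [hs hM]; split; last exact: IH hL hM.
move=> z rz; rewrite hr //= hs.
  by rewrite /rect_map /= !dyadic_map_comp.
by case: rz => z1 z2; split; apply: dyadic_map_interval.
Qed.

Lemma rect_of_children c r z : rect_of (child1 c r) z \/ rect_of (child2 c r) z <-> rect_of r z.
Proof.
case: r => d e; rewrite /rect_of.
case: c => /=; have := interval_halves d z.1; have := interval_halves e z.2;
  rewrite /setX /=; tauto.
Qed.

Lemma rect_map_child1 c r s z : rect_map (child1 c r) (child1 c s) z = rect_map r s z.
Proof. by case: c; rewrite /rect_map /= ?dyadic_map_lo ?dyadic_map_hi. Qed.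

Lemma rect_map_child2 c r s z : rect_map (child2 c r) (child2 c s) z = rect_map r s z.
Proof. by case: c; rewrite /rect_map /= ?dyadic_map_lo ?dyadic_map_hi. Qed.

Lemma maps_rects_leaves g r s t : maps_rects g [:: r] [:: s] ->
  maps_rects g (leaves_from r t) (leaves_from s t).
Proof.
elim: t r s => [|c t1 IH1 t2 IH2] r s // [hrs _].
rewrite !leaves_from_Node; apply/maps_rects_cat; first by rewrite !size_leaves_from.
by split; [apply: IH1|apply: IH2]; split=> // z rz;
  rewrite ?rect_map_child1 ?rect_map_child2; apply: hrs;
  apply/(rect_of_children c); tauto.
Qed.

(** The affine map of [r] onto [s] carries halves to halves, so the same tree may be hung at
    corresponding places of source and target. *)
Lemma maps_rects_refine g L1 r L2 M1 s M2 t : size L1 = size M1 ->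
  maps_rects g (L1 ++ r :: L2) (M1 ++ s :: M2) ->
  maps_rects g (L1 ++ leaves_from r t ++ L2) (M1 ++ leaves_from s t ++ M2).
Proof.
move=> eqs /maps_rects_cat -/(_ eqs)[h1 [hr h2]].
apply/maps_rects_cat => //; split=> //.
apply/maps_rects_cat; first by rewrite !size_leaves_from.
by split=> //; apply: maps_rects_leaves.
Qed.

(** Used for the [find] in [tree_pair_map]: a point lies in only one leaf, so any leaf known to
    contain it is the one found. *)
Lemma find_count1 (T : Type) (a : pred T) (x0 : T) (s : seq T) (k : nat) : count a s = 1%N ->
  (k < size s)%N -> a (nth x0 s k) -> find a s = k.
Proof.
elim: s k => [|y s IH] //= [|k] /=; first by move=> _ _ ->.
case: (a y) => /= [[] c0 ltk ak|c1 ltk ak]; last by rewrite (IH k).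
suff: has a s by rewrite has_count -[count a s]add0n c0.
by apply/(has_nthP x0); exists k.
Qed.

Lemma unit_rectP z : rect_of unit_rect z <-> unit_square z.
Proof.
rewrite /rect_of /unit_square /interval_of /setX /= expr0 invr1 !mulr1.
by split=> [[] -> ->|/andP[]].
Qed.

Lemma tree_pair_map_maps (S T : tree) : nleaves S = nleaves T ->
  maps_rects (@tree_pair_map R S T) (leaves S) (leaves T).
Proof.
move=> eqn; apply: maps_rects_nth => // k z ltk zk.
have c1 : count (fun s => in_rect s z) (leaves S) = 1%N.
  have : (0 < count (fun s => in_rect s z) (leaves S))%N.
    by rewrite -has_count; apply/(has_nthP unit_rect); exists k => //; apply/asboolP.
  by rewrite /leaves count_leaves; case: in_rect.
rewrite /tree_pair_map (find_count1 (x0 := unit_rect) c1 ltk) //.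
exact/asboolP.
Qed.

(** The leaves of [S] cover the unit square, so a map prescribed on each of them is determined
    there. *)
Lemma eq_tree_pair_map g (S T : tree) : maps_rects g (leaves S) (leaves T) ->
  nleaves S = nleaves T ->
  forall z, unit_square z -> g z = tree_pair_map S T z.
Proof.
move=> hg eqn z /unit_rectP uz.
have : has (fun s => in_rect s z) (leaves S).
  by rewrite has_count /leaves count_leaves; have -> : in_rect unit_rect z by apply/asboolP.
move=> /(has_nthP unit_rect)[k ltk /asboolP zk].
rewrite (nth_maps_rects hg ltk zk).
by rewrite (nth_maps_rects (tree_pair_map_maps eqn) ltk zk).
Qed.

End DyadicGeometry.

(** * The word of a tree *)

Section Words.
Local Open Scope classical_set_scope.
Local Open Scope ring_scope.
Variable R : realType.
Implicit Types (r s : drect) (t : tree) (w : word) (L : seq drect) (c : Defs.shape).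

Lemma nth_cat_size (T : Type) (x0 x : T) (X Y : seq T) k :
  size X = k -> nth x0 (X ++ x :: Y) k = x.
Proof. by move=> <-; rewrite nth_cat ltnn subnn. Qed.

Lemma leaves_from_graft r t k u : (k < nleaves t)%N ->
  leaves_from r (graft t k u)
  = take k (leaves_from r t) ++ leaves_from (nth unit_rect (leaves_from r t) k) u
    ++ drop k.+1 (leaves_from r t).
Proof.
elim: t r k => [|c t1 IH1 t2 IH2] r k.
  by case: k => //= _; rewrite cats0.
rewrite nleaves_Node [graft _ _ _]/=; case: (ltnP k (nleaves t1)) => ltk.
  move=> _; rewrite !leaves_from_Node IH1 // take_cat nth_cat drop_cat !size_leaves_from ltk.
  case: (ltngtP k.+1 (nleaves t1)) ltk => // [_ _|]; first by rewrite -!catA.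
  by move=> e _; rewrite drop_oversize ?size_leaves_from e // subnn drop0 cats0 -catA.
move=> ltk2; have ltk' : (k - nleaves t1 < nleaves t2)%N by lia.
rewrite !leaves_from_Node IH2 // take_cat nth_cat drop_cat !size_leaves_from.
by rewrite !ltnNge ltk (leq_trans ltk) //= -catA subSn.
Qed.

Lemma leaves_from_graft_cat r t X q Y u : leaves_from r t = X ++ q :: Y ->
  leaves_from r (graft t (size X) u) = X ++ leaves_from q u ++ Y.
Proof.
move=> eqL; rewrite leaves_from_graft ?eqL.
  by rewrite nth_cat_size // take_size_cat // -cat_rcons drop_size_cat ?size_rcons.
by rewrite -(size_leaves_from r) eqL size_cat /= addnS ltnS leq_addr.
Qed.

(** [X] and [r] do not depend on [j]: right trees with at least [i] carets share their first [i]
    leaves and differ only inside [r]. *)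
Lemma right_tree_leaves i : exists X r, size X = i /\
  forall j, leaves (right_tree (i + j)) = X ++ leaves_from r (right_tree j).
Proof.
rewrite /leaves; elim: i unit_rect => [|i IH] r; first by exists [::], r.
have [X [q [sX eqX]]] := IH (child2 Tri r).
exists (child1 Tri r :: X), q; split=> [|j]; first by rewrite /= sX.
by rewrite addSn /= -eqX.
Qed.

Lemma nleaves_right_tree k : nleaves (right_tree k) = k.+1.
Proof. by elim: k => // k IH; rewrite /= nleaves_Node IH. Qed.

Lemma word_map_cat u w z : word_map (R := R) (u ++ w) z = word_map w (word_map u z).
Proof. by elim: u z => //= x u IH z. Qed.

(** A list version of [corresponds], for the partial subdivisions met while a tree is being
    built. *)
Definition realizes w L :=
  maps_rects (word_map (R := R) w) L (leaves (right_tree (size L).-1)).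

Lemma realizes_corresponds w t : realizes w (leaves t) -> corresponds R w t.
Proof.
move=> hw z uz; apply: eq_tree_pair_map uz => //.
by rewrite nleaves_right_tree prednK // nleaves_gt0.
Qed.

Definition caret c : tree := Node c Leaf Leaf.
Definition inner_letter c : nat -> letter := if c is Tri then A_ else B_.
Definition spine_letter c i : word := if c is Tri then [::] else [:: C_ i].

Lemma letter_map_inner c i : letter_map (R := R) (inner_letter c i)
  = tree_pair_map (graft (right_tree i.+1) i (caret c)) (right_tree i.+2).
Proof. by case: c. Qed.

Lemma maps_rects_id L : maps_rects (fun z : R * R => z) L L.
Proof.
elim: L => //= r L IH; split=> // z _; rewrite /rect_map !dyadic_mapE.
have n0 d := lt0r_neq0 (width_gt0 R d).
by rewrite !divff // !mulr1 !subrK; case: z.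
Qed.

Lemma eq_maps_rects (g h : R * R -> R * R) L L' :
  h =1 g -> maps_rects h L L' -> maps_rects g L L'.
Proof. by move=> /funext ->. Qed.

Lemma realizes_nil : realizes [::] (leaves Leaf).
Proof. exact: maps_rects_id. Qed.

(** As [L2] is nonempty, target rectangle number [i] is the left half of [s], not a last leaf. The
    new caret is copied onto it, and the letter, extended by a right tree at its last leaf, restores
    a right tree. *)
Lemma realizes_inner_letter w L1 r L2 c : L2 != [::] -> realizes w (L1 ++ r :: L2) ->
  realizes (w ++ [:: inner_letter c (size L1)]) (L1 ++ child1 c r :: child2 c r :: L2).
Proof.
case: L2 => // r2 L2 _; rewrite /realizes !size_cat [size (_ :: _)]/= [size [:: _, _ & _]]/=.
set i := size L1; set j := size L2.
have [X [s [sX eqX]]] := right_tree_leaves i.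
have predE k : (i + k.+1).-1 = (i + k)%N by rewrite addnS.
rewrite !predE !eqX => hL.
have hw : maps_rects (@word_map R w) (L1 ++ [:: child1 c r, child2 c r, r2 & L2])
    (X ++ leaves_from (child1 Tri s) (caret c) ++ leaves_from (child2 Tri s) (right_tree j)).
  have := maps_rects_refine (caret c) (esym sX) hL.
  by rewrite (leaves_from_Node r).
apply: (@eq_maps_rects _ (letter_map (inner_letter c i) \o word_map w)).
  by move=> z; rewrite word_map_cat.
apply: maps_rects_comp hw _; rewrite letter_map_inner.
set S := graft _ _ _; set T := right_tree i.+2.
have eqS : leaves S = X ++ leaves_from (child1 Tri s) (caret c) ++ [:: child2 Tri s].
  by rewrite /S -{2}sX; apply: leaves_from_graft_cat; rewrite -addn1 -/(leaves _) eqX.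
have eqT : leaves T =
    X ++ leaves_from (child1 Tri s) Leaf ++ leaves_from (child2 Tri s) (caret Tri).
  by rewrite /T -addn2 eqX.
have eqn : nleaves S = nleaves T.
  by rewrite /nleaves eqS eqT !size_cat !size_leaves_from nleaves_Node.
set s1 := child1 Tri s; set s2 := child2 Tri s.
(* The last leaf is split off on both sides: the trees of the letter stop there, and [right_tree j]
   has to be hung from it. *)
have hT : maps_rects (@tree_pair_map R S T)
    ((X ++ leaves_from s1 (caret c)) ++ [:: s2])
    ((X ++ [:: s1; child1 Tri s2]) ++ [:: child2 Tri s2]).
  by have := tree_pair_map_maps R eqn; rewrite eqS eqT -!catA.
have eqz : size (X ++ leaves_from s1 (caret c)) = size (X ++ [:: s1; child1 Tri s2]).
  by rewrite !size_cat size_leaves_from nleaves_Node.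
have := maps_rects_refine (right_tree j) eqz hT.
by rewrite !cats0 -!catA.
Qed.

Lemma realizes_spine_letter w L1 r c : realizes w (L1 ++ [:: r]) ->
  realizes (w ++ spine_letter c (size L1)) (L1 ++ [:: child1 c r; child2 c r]).
Proof.
rewrite /realizes !size_cat addn1 addn2 [_.+1.-1]/= [_.+2.-1]/=.
set i := size L1.
have [X [s [sX eqX]]] := right_tree_leaves i.
have eqi : leaves (right_tree i) = X ++ [:: s] by rewrite -[i]addn0 eqX.
have eqi1 : leaves (right_tree i.+1) = X ++ leaves_from s (caret Tri) by rewrite -addn1 eqX.
rewrite eqi eqi1 => hL.
have hw : maps_rects (@word_map R w) (L1 ++ [:: child1 c r; child2 c r])
    (X ++ leaves_from s (caret c)).
  have := maps_rects_refine (caret c) (esym sX) hL.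
  by rewrite (leaves_from_Node r) !cats0.
case: c hw => hw /=; first by rewrite cats0.
apply: (@eq_maps_rects _ (letter_map (C_ i) \o word_map w)).
  by move=> z; rewrite word_map_cat.
apply: maps_rects_comp hw _; rewrite -eqi1 /=.
set S := graft _ _ _.
have eqS : leaves S = X ++ leaves_from s (caret Sq).
  have := leaves_from_graft_cat (caret Sq) eqi.
  by rewrite sX cats0.
rewrite -eqS; apply: tree_pair_map_maps.
rewrite -[Node Tri _ _]/(right_tree i.+1) nleaves_right_tree.
by rewrite /nleaves eqS !size_cat /= sX addn2.
Qed.

(** Carets in preorder, each indexed by the leaf that it splits. When the right subtree is started
    the left one is complete, hence the shift by [nleaves t1]. *)
Fixpoint inner_word i t : word :=
  if t is Node c t1 t2 then
    inner_letter c i :: inner_word i t1 ++ inner_word (i + nleaves t1)%N t2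
  else [::].

(** The spine is built while all its left children are still leaves, so the index of the last leaf
    grows by one with each caret. *)
Fixpoint spine_word i t : word :=
  if t is Node c _ t2 then spine_letter c i ++ spine_word i.+1 t2 else [::].

Fixpoint off_spine_word i t : word :=
  if t is Node _ t1 t2 then inner_word i t1 ++ off_spine_word (i + nleaves t1)%N t2
  else [::].

Fixpoint spine_leaves r t : seq drect :=
  if t is Node c _ t2 then child1 c r :: spine_leaves (child2 c r) t2 else [:: r].

Lemma realizes_inner_word w L1 r L2 t : L2 != [::] -> realizes w (L1 ++ r :: L2) ->
  realizes (w ++ inner_word (size L1) t) (L1 ++ leaves_from r t ++ L2).
Proof.
elim: t w L1 r L2 => [|c t1 IH1 t2 IH2] w L1 r L2 nL2 hw; first by rewrite cats0.
rewrite [inner_word _ _]/= -cat1s catA catA.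
have := IH1 _ _ _ _ _ (realizes_inner_letter c nL2 hw).
(* While [t1] is built, the second half of [r] still follows, so the leaf being split is never the
   last one. *)
move=> /(_ isT); rewrite catA => /(IH2 _ _ _ _ nL2).
by rewrite leaves_from_Node size_cat size_leaves_from -!catA.
Qed.

Lemma realizes_spine_word w L1 r t : realizes w (L1 ++ [:: r]) ->
  realizes (w ++ spine_word (size L1) t) (L1 ++ spine_leaves r t).
Proof.
elim: t w L1 r => [|c t1 _ t2 IH] w L1 r hw; first by rewrite cats0.
have := realizes_spine_letter c hw; rewrite -cat1s catA => /IH.
by rewrite size_cat addn1 /= -!catA.
Qed.

Lemma realizes_off_spine_word w L1 r t : realizes w (L1 ++ spine_leaves r t) ->
  realizes (w ++ off_spine_word (size L1) t) (L1 ++ leaves_from r t).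
Proof.
elim: t w L1 r => [|c t1 _ t2 IH] w L1 r hw; first by rewrite cats0.
have := realizes_inner_word t1 _ hw; rewrite catA => -/(_ _)/IH.
rewrite leaves_from_Node /= size_cat size_leaves_from -!catA; apply.
(* What follows the left subtree is [spine_leaves], which is never empty. *)
by case: (t2).
Qed.

Definition tree_word t : word := spine_word 0 t ++ off_spine_word 0 t.

Lemma tree_word_realizes t : realizes (tree_word t) (leaves t).
Proof.
exact: (@realizes_off_spine_word _ [::] _ _ (@realizes_spine_word [::] [::] _ t realizes_nil)).
Qed.

(** The bound makes [j] a leaf other than the last, so even the spine carets of [u] lie off the
    spine of the grafted tree. *)
Lemma tree_word_graft t j u : (j.+1 < nleaves t)%N ->
  realizes (tree_word t ++ inner_word j u) (leaves (graft t j u)).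
Proof.
move=> ltj; have ltj' := ltnW ltj; rewrite /leaves leaves_from_graft //.
have := tree_word_realizes t.
rewrite -{1}(cat_take_drop j (leaves t)) (drop_nth unit_rect) //.
have sj : size (take j (leaves t)) = j by rewrite size_takel // ltnW.
move=> hw; rewrite -{1}sj; apply: realizes_inner_word hw.
by rewrite -size_eq0 size_drop subn_eq0 -ltnNge.
Qed.
End Words.

(** * Leaf exponents *)

Section Exponents.
Local Open Scope nat_scope.
Implicit Types (s t : tree) (c : Defs.shape) (F : nat -> nat -> word).

(** [k] is the number of left edges directly above the root of [t]; a right edge resets it. *)
Fixpoint left_exponents k t : seq nat :=
  if t is Node _ t1 t2 then left_exponents k.+1 t1 ++ left_exponents 0 t2 else [:: k].

(* The last leaf, whose exponent is 0, is left out. *)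
Fixpoint off_spine_exponents t : seq nat :=
  if t is Node _ t1 t2 then left_exponents 0 t1 ++ off_spine_exponents t2 else [::].

Lemma size_left_exponents k t : size (left_exponents k t) = nleaves t.
Proof. by elim: t k => //= c t1 IH1 t2 IH2 k; rewrite size_cat nleaves_Node IH1 IH2. Qed.

Lemma size_leaf_paths t : size (leaf_paths t) = nleaves t.
Proof. by elim: t => //= c t1 IH1 t2 IH2; rewrite size_cat nleaves_Node !size_map IH1 IH2. Qed.

Lemma size_off_spine_exponents t : size (off_spine_exponents t) = (nleaves t).-1.
Proof.
elim: t => //= c t1 _ t2 IH; rewrite size_cat nleaves_Node size_left_exponents IH.
by have := nleaves_gt0 t2; case: (nleaves t2) => // k _; rewrite addnS.
Qed.

Lemma left_run_true p q : left_run (p ++ true :: q) = left_run q.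
Proof.
rewrite /left_run rev_cat rev_cons find_cat -cats1 has_cat orbT /=.
rewrite find_cat; case: ifP => // hq.
by rewrite /= addn0 hasNfind // hq.
Qed.

Lemma left_run_nseq k : left_run (nseq k false) = k.
Proof.
rewrite /left_run rev_nseq hasNfind ?size_nseq //.
by rewrite has_nseq andbF.
Qed.

Lemma left_exponentsE k t :
  left_exponents k t = [seq left_run (nseq k false ++ p) | p <- leaf_paths t].
Proof.
elim: t k => [|c t1 IH1 t2 IH2] k; first by rewrite /= cats0 left_run_nseq.
rewrite /= map_cat -!map_comp IH1 IH2; congr (_ ++ _); apply: eq_map => p /=.
  by rewrite -[false :: p]cat1s catA -[[:: false]]/(nseq 1 false) -nseqD addn1.
by rewrite left_run_true.
Qed.

Lemma nth_map_default (T1 T2 : Type) (x : T1) (f : T1 -> T2) (l : seq T1) i :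
  nth (f x) (map f l) i = f (nth x l i).
Proof. by elim: l i => [|y l IH] [|i] //=. Qed.

Lemma full_leaf_exponentE t i : full_leaf_exponent t i = nth 0%N (left_exponents 0 t) i.
Proof.
rewrite left_exponentsE /full_leaf_exponent.
by rewrite -[RHS]/(nth (left_run [::]) _ _) nth_map_default.
Qed.

Definition path_exponent p : nat :=
  count (fun k => ~~ all id (take k p)) (iota (size p - left_run p) (left_run p)).

Lemma left_run_size p : (left_run p <= size p)%N.
Proof. by rewrite /left_run -[size p]size_rev find_size. Qed.

Lemma left_run_false p : left_run (false :: p) =
  if left_run p == size p then (size p).+1 else left_run p.
Proof.
rewrite /left_run rev_cons -cats1 find_cat has_find size_rev /= addn1.
by case: (ltngtP (find id (rev p)) (size p)) (left_run_size p).
Qed.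

(** After an initial left edge the path never returns to the spine, so at most that first edge is
    excluded from the count. *)
Lemma path_exponent_false p : path_exponent (false :: p) = left_run p.
Proof.
rewrite /path_exponent left_run_false; case: eqP => [->|/eqP ne] /=.
  rewrite subnn /= add0n -[RHS](size_iota 1); apply/eqP; rewrite -all_count.
  by apply/allP => k; rewrite mem_iota; case: k.
have lt : (left_run p < size p)%N by rewrite ltn_neqAle ne left_run_size.
rewrite subSn ?left_run_size // -[RHS](size_iota (size p - left_run p).+1).
apply/eqP; rewrite -all_count.
by apply/allP => k; rewrite mem_iota; case: k.
Qed.

Lemma path_exponent_true p : path_exponent (true :: p) = path_exponent p.
Proof.
rewrite /path_exponent -cat1s -[[:: true]]/([::] ++ [:: true]) cat0s.
rewrite (left_run_true [::] p) /= subSn ?left_run_size // -add1n iotaDl count_map.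
by apply: eq_count.
Qed.

Lemma leaf_exponentE t i : leaf_exponent t i = nth 0%N (off_spine_exponents t) i.
Proof.
rewrite -[LHS]/(path_exponent (nth [::] (leaf_paths t) i)).
rewrite -(nth_map_default [::] path_exponent).
(* The list omits the last leaf, of exponent 0; the default value of [nth] supplies this 0. *)
suff -> : map path_exponent (leaf_paths t) = rcons (off_spine_exponents t) 0%N.
  rewrite nth_rcons; case: ltngtP => // [|->]; last by rewrite nth_default.
  by move=> /ltnW h; rewrite nth_default.
elim: t => [|c t1 _ t2 IH] //=.
rewrite map_cat -!map_comp (eq_map path_exponent_false) (eq_map path_exponent_true) IH.
by rewrite rcons_cat left_exponentsE.
Qed.

(** A path leaves the spine by a single left edge, so a run of left edges has at most one edge whose
    upper endpoint is on the spine. *)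
Lemma full_leaf_exponent_spine t i :
  full_leaf_exponent t i = leaf_exponent t i \/
  full_leaf_exponent t i = (leaf_exponent t i).+1.
Proof.
rewrite /full_leaf_exponent -[leaf_exponent t i]/(path_exponent (leaf_path t i)).
elim: (leaf_path t i) => [|[] p IH]; first by left.
  by rewrite (left_run_true [::]) path_exponent_true.
rewrite path_exponent_false left_run_false.
by case: eqP => [<-|_]; [right|left].
Qed.

(** [F e i] is the block of leaf [i] with exponent [e]: a power of a letter, possibly followed by
    the word of a tree hung from that leaf. *)
Fixpoint exponent_word F i (l : seq nat) : word :=
  if l is e :: l' then F e i ++ exponent_word F i.+1 l' else [::].

Lemma exponent_word_cat F i l1 l2 : exponent_word F i (l1 ++ l2)
  = exponent_word F i l1 ++ exponent_word F (i + size l1) l2.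
Proof.
elim: l1 i => [|e l1 IH] i /=; first by rewrite addn0.
by rewrite IH catA addSnnS.
Qed.

Lemma exponent_word_iota F i (e : nat -> nat) l n :
  size l = n -> (forall p, (p < n)%N -> e p = nth 0%N l p) ->
  flatten [seq F (e p) (i + p)%N | p <- iota 0 n] = exponent_word F i l.
Proof.
elim: l i e n => [|x l IH] i e [|n] //= [sl] he.
rewrite addn0 (he 0%N) //= -(IH i.+1 (e \o succn) n) //; last by move=> p; apply: (he p.+1).
congr (_ ++ flatten _).
rewrite -[1%N]addn0 iotaDl -map_comp; apply: eq_map => p /=.
by rewrite add1n addnS addSn.
Qed.

Lemma nleaves_hang s t : nleaves (hang s t) = (nleaves t * nleaves s)%N.
Proof.
elim: s => [|c s1 IH1 s2 IH2] /=; first by rewrite muln1.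
by rewrite !nleaves_Node IH1 IH2 mulnDr.
Qed.

Lemma hang_Leaf s : hang s Leaf = s.
Proof. by elim: s => //= c s1 -> s2 ->. Qed.

Definition leaf_block c t e i : word :=
  nseq e (inner_letter c (nleaves t * i)) ++ inner_word (nleaves t * i) t.

(** In preorder a caret is indexed by its leftmost leaf, so the carets of one left path give equal
    consecutive letters, just before the copy of [t] at that leaf. [k] counts those already emitted
    above [s]. *)
Lemma inner_word_hang c s t k i : all_shape (fun d => d = c) s ->
  nseq k (inner_letter c (nleaves t * i)) ++ inner_word (nleaves t * i) (hang s t)
  = exponent_word (leaf_block c t) i (left_exponents k s).
Proof.
elim: s k i => [|d s1 IH1 s2 IH2] k i /=; first by rewrite cats0.
move=> [-> h1 h2]; rewrite exponent_word_cat -IH1 // -IH2 //= size_left_exponents.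
rewrite nleaves_hang mulnDr -!catA.
by elim: k => //= k ->.
Qed.

(** The copy of [t] at the last leaf of [s] continues the spine, so only its off-spine carets
    appear; hence the different form of the last factor. *)
Lemma off_spine_word_hang c s t i : all_shape (fun d => d = c) s ->
  off_spine_word (nleaves t * i) (hang s t)
  = exponent_word (leaf_block c t) i (off_spine_exponents s)
    ++ off_spine_word (nleaves t * (i + (nleaves s).-1)) t.
Proof.
elim: s i => [|d s1 IH1 s2 IH2] i /=; first by rewrite addn0.
move=> [-> h1 h2]; rewrite exponent_word_cat -inner_word_hang //= -catA.
rewrite nleaves_hang -mulnDr IH2 // size_left_exponents -addnA nleaves_Node.
by have := nleaves_gt0 s2; case: (nleaves s2) => // q; rewrite addnS.
Qed.

Lemma leaf_block_Leaf c e i : leaf_block c Leaf e i = nseq e (inner_letter c i).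
Proof. by rewrite /leaf_block mul1n cats0. Qed.

Lemma inner_word_exponents c t i m : all_shape (fun d => d = c) t -> nleaves t = m.+1 ->
  inner_word i t = flatten [seq nseq (full_leaf_exponent t p) (inner_letter c (i + p))
                           | p <- iota 0 m.+1].
Proof.
move=> ht eqm; have := inner_word_hang Leaf 0 i ht; rewrite hang_Leaf mul1n [nseq 0 _ ++ _]/= => ->.
rewrite -(@exponent_word_iota (leaf_block c Leaf) i (full_leaf_exponent t) _ m.+1).
- by congr flatten; apply: eq_map => p; rewrite leaf_block_Leaf.
- by rewrite size_left_exponents.
- by move=> p _; rewrite full_leaf_exponentE.
Qed.

Lemma leaf_exponent_last t m : nleaves t = m.+1 -> leaf_exponent t m = 0%N.
Proof.
by move=> eqm; rewrite leaf_exponentE nth_default // size_off_spine_exponents eqm.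
Qed.

Lemma off_spine_word_exponents c t i m : all_shape (fun d => d = c) t -> nleaves t = m.+1 ->
  off_spine_word i t = flatten [seq nseq (leaf_exponent t p) (inner_letter c (i + p))
                               | p <- iota 0 m.+1].
Proof.
move=> ht eqm; have := off_spine_word_hang Leaf i ht.
rewrite hang_Leaf mul1n [off_spine_word _ Leaf]/= cats0 => ->.
(* The product runs up to index [m], but the last leaf has exponent 0 and adds no letter. *)
rewrite -[m.+1]addn1 iotaD map_cat flatten_cat /= (leaf_exponent_last eqm) /= cats0.
rewrite -(@exponent_word_iota (leaf_block c Leaf) i (leaf_exponent t) _ m).
- by congr flatten; apply: eq_map => p; rewrite leaf_block_Leaf.
- by rewrite size_off_spine_exponents eqm.
- by move=> p _; rewrite leaf_exponentE.
Qed.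

Lemma spine_word_tri t i : only_tri t -> spine_word i t = [::].
Proof. by elim: t i => //= c t1 _ t2 IH i [-> _ h2]; rewrite IH. Qed.

Lemma spine_word_sq t i : only_sq t -> spine_word i t = C_word i (spine_size t).
Proof. by elim: t i => //= c t1 _ t2 IH i [-> _ h2]; rewrite IH. Qed.

Lemma spine_word_hang s t i :
  spine_word i (hang s t) = spine_word i s ++ spine_word (i + spine_size s) t.
Proof.
elim: s i => [|c s1 _ s2 IH] i /=; first by rewrite addn0.
by rewrite IH addSnnS catA.
Qed.

Lemma graft_last c s1 s2 t : graft (Node c s1 s2) (nleaves (Node c s1 s2)).-1 t
  = Node c s1 (graft s2 (nleaves s2).-1 t).
Proof.
rewrite /= nleaves_Node; have := nleaves_gt0 s2; case: (nleaves s2) => // q _.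
by rewrite addnS ltnNge leq_addr /= addKn.
Qed.

Lemma spine_word_graft s t i : spine_word i (graft s (nleaves s).-1 t)
  = spine_word i s ++ spine_word (i + spine_size s) t.
Proof.
elim: s i => [|c s1 _ s2 IH] i; first by rewrite addn0.
by rewrite graft_last /= IH addSnnS catA.
Qed.

Lemma off_spine_word_graft s t i : off_spine_word i (graft s (nleaves s).-1 t)
  = off_spine_word i s ++ off_spine_word (i + (nleaves s).-1) t.
Proof.
elim: s i => [|c s1 _ s2 IH] i; first by rewrite addn0.
rewrite graft_last /= IH catA nleaves_Node -addnA.
by have := nleaves_gt0 s2; case: (nleaves s2) => // q; rewrite addnS.
Qed.

(** Triangular spine carets cost no letters, and [off_spine_word] ignores the shapes on the
    spine. *)
Lemma tree_word_tri_spine t : tree_word (tri_spine t) = off_spine_word 0 t.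
Proof.
rewrite /tree_word; move: {1 2 3}0%N => i.
have -> j : spine_word j (tri_spine t) = [::] by elim: t j => //= c t1 _ t2 IH j; rewrite IH.
by elim: t i => //= c t1 _ t2 IH i; rewrite IH.
Qed.

Lemma A_wordE t n : only_tri t -> nleaves t = n.+1 ->
  A_word (leaf_exponent t) n = tree_word t.
Proof.
move=> ht eqn; rewrite /tree_word spine_word_tri //.
by rewrite (off_spine_word_exponents 0 ht eqn).
Qed.

Lemma B_word_inner t m i : only_sq t -> nleaves t = m.+1 ->
  B_word i (full_leaf_exponent t) m = inner_word i t.
Proof. by move=> ht eqm; rewrite (inner_word_exponents i ht eqm). Qed.

Lemma B_word_off_spine t m i : only_sq t -> nleaves t = m.+1 ->
  B_word i (leaf_exponent t) m = off_spine_word i t.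
Proof. by move=> ht eqm; rewrite (off_spine_word_exponents i ht eqm). Qed.

Lemma grid_wordE Tv Th : only_tri Tv -> only_sq Th ->
  grid_word Tv Th = tree_word (hang Tv Th).
Proof.
move=> hv hh; have := nleaves_gt0 Tv; have := nleaves_gt0 Th.
case eqm: (nleaves Th) => [|m] // _; case eqn: (nleaves Tv) => [|n] // _.
rewrite /grid_word /tree_word eqm eqn spine_word_hang spine_word_tri // spine_word_sq //.
have := off_spine_word_hang Th 0 hv; rewrite muln0 add0n => ->.
rewrite eqm eqn /= (leaf_exponent_last eqn) /= B_word_off_spine //.
congr (_ ++ (_ ++ _)).
rewrite -(@exponent_word_iota (leaf_block Tri Th) 0 (leaf_exponent Tv) _ n).
- congr flatten; apply: eq_map => j.
  by rewrite B_word_inner // /leaf_block eqm add0n.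
- by rewrite size_off_spine_exponents eqn.
- by move=> p _; rewrite leaf_exponentE.
Qed.

End Exponents.

(** * Reduced grids *)

Section AbstractGrids.
Local Open Scope classical_set_scope.
Local Open Scope ring_scope.
Implicit Types (s t u : tree).

(** Leaves over any type with two halving maps, caret shapes being ignored, so that the vertical and
    horizontal directions share one argument. *)
Fixpoint cells (T : Type) (h1 h2 : T -> T) (I : T) t : seq T :=
  if t is Node _ t1 t2 then cells h1 h2 (h1 I) t1 ++ cells h1 h2 (h2 I) t2 else [:: I].

Lemma size_cells (T : Type) (h1 h2 : T -> T) (I : T) t :
  size (cells h1 h2 I t) = nleaves t.
Proof. by elim: t I => //= c t1 IH1 t2 IH2 I; rewrite size_cat nleaves_Node IH1 IH2. Qed.

Lemma leaf_path_Node c t1 t2 i : leaf_path (Node c t1 t2) i =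
  if (i < nleaves t1)%N then false :: leaf_path t1 i
  else if (i - nleaves t1 < nleaves t2)%N then true :: leaf_path t2 (i - nleaves t1)
  else [::].
Proof.
rewrite /leaf_path /= nth_cat size_map size_leaf_paths; case: ltnP => lti.
  by rewrite (nth_map [::]) ?size_leaf_paths.
case: ltnP => lti2; first by rewrite (nth_map [::]) ?size_leaf_paths.
by rewrite nth_default // size_map size_leaf_paths.
Qed.

Lemma leaf_path_nil t i : (i < nleaves t)%N -> leaf_path t i = [::] -> t = Leaf.
Proof.
case: t => // c t1 t2; rewrite nleaves_Node leaf_path_Node.
by case: (ltnP i (nleaves t1)) => // le1 lti; rewrite ltn_subLR // lti.
Qed.

Lemma exposed_bound t i : exposed t i -> (i.+1 < nleaves t)%N.
Proof.
case=> q [_ e2]; rewrite ltnNge; apply/negP => le.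
by move: e2; rewrite /leaf_path nth_default ?size_leaf_paths //; case: q.
Qed.

Lemma exposed_left c t1 t2 i : exposed t1 i -> exposed (Node c t1 t2) i.
Proof.
move=> ex; have lt := exposed_bound ex; case: ex => q [e1 e2]; exists (false :: q).
by rewrite !leaf_path_Node lt (ltnW lt) e1 e2.
Qed.

Lemma exposed_right c t1 t2 i : exposed t2 i -> exposed (Node c t1 t2) (nleaves t1 + i).
Proof.
move=> ex; have lt := exposed_bound ex; case: ex => q [e1 e2]; exists (true :: q).
have n1 k : (nleaves t1 + k < nleaves t1)%N = false by rewrite ltnNge leq_addr.
by rewrite -addnS !leaf_path_Node !n1 !addKn lt (ltnW lt) e1 e2.
Qed.

Lemma exposed_root c : exposed (Node c Leaf Leaf) 0.
Proof. by exists [::]. Qed.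

Lemma exposed_Node c t1 t2 i : exposed (Node c t1 t2) i ->
  [\/ [/\ t1 = Leaf, t2 = Leaf & i = 0%N], exposed t1 i
    | exists2 i', i = (nleaves t1 + i')%N & exposed t2 i'].
Proof.
case=> [[|[] q]] []; rewrite !leaf_path_Node /=.
- case: (ltnP i) => lt1; last by case: ifP.
  case=> e1; case: (ltnP i.+1) => lt2 //.
  case: ltnP => // lt3 [e2].
  have t1L := leaf_path_nil lt1 e1; have t2L := leaf_path_nil lt3 e2.
  by constructor 1; split => //; move: lt1; rewrite t1L; case: (i).
- case: (ltnP i) => // le1; rewrite [(i.+1 < nleaves t1)%N]ltnNge (leqW le1) subSn //.
  case: ltnP => // _ [e1]; case: ltnP => // _ [e2].
  constructor 3; exists (i - nleaves t1)%N; first by rewrite subnKC.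
  by exists q.
- case: (ltnP i) => lt1; last by case: ifP.
  case=> e1; case: (ltnP i.+1) => lt2; last by case: ifP.
  by case=> e2; constructor 2; exists q.
Qed.

(** [t'] is [t] without the exposed caret: two neighbouring cells merge into their parent [P]. *)
Lemma exposed_prune (T : Type) (h1 h2 : T -> T) (I : T) t i : exposed t i ->
  exists X P Y t', [/\ size X = i, cells h1 h2 I t = X ++ h1 P :: h2 P :: Y,
    cells h1 h2 I t' = X ++ P :: Y & forall q, all_shape q t -> all_shape q t'].
Proof.
elim: t I i => [|c t1 IH1 t2 IH2] I i; first by move/exposed_bound.
move=> /exposed_Node[[-> -> ->]|ex1|[i' -> ex2]].
- by exists [::], I, [::], Leaf.
- have [X [P [Y [t' [sX e1 e2 sh]]]]] := IH1 (h1 I) _ ex1.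
  exists X, P, (Y ++ cells h1 h2 (h2 I) t2), (Node c t' t2).
  by rewrite /= e1 e2 -!catA; split=> // q [? /sh ? ?]; split.
- have [X [P [Y [t' [sX e1 e2 sh]]]]] := IH2 (h2 I) _ ex2.
  exists (cells h1 h2 (h1 I) t1 ++ X), P, Y, (Node c t1 t').
  rewrite /= e1 e2 -!catA size_cat size_cells sX; split=> // q [? ? /sh ?]; split=> //.
Qed.

(** No exposed caret can be removed without creating a cell that violates [H]; the position [size X]
    ties the caret to its pair of cells. *)
Definition reduced_for (T : Type) (h1 h2 : T -> T) (I : T) t (H : T -> Prop) : Prop :=
  forall X P Y, exposed t (size X) -> cells h1 h2 I t = X ++ h1 P :: h2 P :: Y -> ~ H P.

(** The common part of the two trees, growing from the root. *)
Fixpoint tree_meet t s : tree :=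
  match t, s with
  | Node c t1 t2, Node _ s1 s2 => Node c (tree_meet t1 s1) (tree_meet t2 s2)
  | _, _ => Leaf
  end.

Lemma tree_meetC c s t : all_shape (fun d => d = c) s -> all_shape (fun d => d = c) t ->
  tree_meet s t = tree_meet t s.
Proof.
elim: s t => [|d s1 IH1 s2 IH2] [|e t1 t2] //= [-> h1 h2] [-> h3 h4].
by rewrite IH1 // IH2.
Qed.

(** * Properties of cells that pass to halves *)

Section Closed.
Variables (T : Type) (h1 h2 : T -> T) (H : T -> Prop).
Hypothesis Hh : forall P, H P -> H (h1 P) /\ H (h2 P).

Lemma exists_exposed I t : t <> Leaf -> H I -> exists X P Y,
  [/\ exposed t (size X), cells h1 h2 I t = X ++ h1 P :: h2 P :: Y & H P].
Proof.
elim: t I => [|c t1 IH1 t2 IH2] I // _ HI.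
case: (pselect (t1 = Leaf)) => [t1L|nt1].
  case: (pselect (t2 = Leaf)) => [t2L|nt2].
    by exists [::], I, [::]; split; rewrite ?t1L ?t2L //; apply: exposed_root.
  have [X [P [Y [ex eX HP]]]] := IH2 (h2 I) nt2 (Hh HI).2.
  exists (cells h1 h2 (h1 I) t1 ++ X), P, Y; split=> //; last by rewrite /= eX -catA.
  by rewrite size_cat size_cells; apply: exposed_right.
have [X [P [Y [ex eX HP]]]] := IH1 (h1 I) nt1 (Hh HI).1.
exists X, P, (Y ++ cells h1 h2 (h2 I) t2); split=> //; last by rewrite /= eX -catA.
exact: exposed_left.
Qed.

End Closed.

Section ClosedEq.
Variables (T : eqType) (h1 h2 : T -> T) (H : T -> Prop).
Hypothesis Hh : forall P, H P -> H (h1 P) /\ H (h2 P).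

Lemma cells_closed I t : H I -> forall P, P \in cells h1 h2 I t -> H P.
Proof.
elim: t I => [|c t1 IH1 t2 IH2] I HI P /=; first by rewrite inE => /eqP->.
by rewrite mem_cat => /orP[]; [apply: IH1|apply: IH2]; case: (Hh HI).
Qed.

Lemma cells_meet_closed I t s : (forall P, P \in cells h1 h2 I (tree_meet t s) -> H P) ->
  forall P, P \in cells h1 h2 I t -> H P.
Proof.
elim: t s I => [|c t1 IH1 t2 IH2] [|d s1 s2] I //= HI.
  have HI0 : H I by apply: HI; rewrite inE.
  exact: (cells_closed (t := Node c t1 t2) HI0).
move=> P; rewrite mem_cat => /orP[].
  by apply: (IH1 s1) => Q hQ; apply: HI; rewrite mem_cat hQ.
by apply: (IH2 s2) => Q hQ; apply: HI; rewrite mem_cat hQ orbT.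
Qed.

(** If [t] exceeds the common part, some leaf of that part carries a nontrivial subtree of [t]. [H]
    passes from this leaf to all cells below it, among them the parent cell of an exposed caret,
    against reducedness. *)
Lemma reduced_for_meet I t s : reduced_for h1 h2 I t H ->
  (forall P, P \in cells h1 h2 I (tree_meet t s) -> H P) -> t = tree_meet t s.
Proof.
move=> red HI; apply: contrapT => ne.
suff [X [P [Y [ex eX HP]]]] : exists X P Y,
  [/\ exposed t (size X), cells h1 h2 I t = X ++ h1 P :: h2 P :: Y & H P].
  exact: red ex eX HP.
elim: t s I {red} HI ne => [|c t1 IH1 t2 IH2] [|d s1 s2] I HI ne //.
  by apply: exists_exposed => //; apply: HI; rewrite inE.
case: (pselect (t1 = tree_meet t1 s1)) => [e1|ne1].
  have ne2 : t2 <> tree_meet t2 s2 by move=> e2; apply: ne; rewrite /= -e1 -e2.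
  have [|X [P [Y [ex eX HP]]]] := IH2 s2 (h2 I) _ ne2.
    by move=> P hP; apply: HI; rewrite /= mem_cat hP orbT.
  exists (cells h1 h2 (h1 I) t1 ++ X), P, Y; split=> //; last by rewrite /= eX -catA.
  by rewrite size_cat size_cells; apply: exposed_right.
have [|X [P [Y [ex eX HP]]]] := IH1 s1 (h1 I) _ ne1.
  by move=> P hP; apply: HI; rewrite /= mem_cat hP.
exists X, P, (Y ++ cells h1 h2 (h2 I) t2); split=> //; last by rewrite /= eX -catA.
exact: exposed_left.
Qed.

(** A leaf of the common part is a leaf of one of the trees; the other has a subtree [u] there,
    possibly trivial. *)
Lemma meet_cells I t s P : P \in cells h1 h2 I (tree_meet t s) ->
  (P \in cells h1 h2 I t /\ exists u, {subset cells h1 h2 P u <= cells h1 h2 I s}) \/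
  (P \in cells h1 h2 I s /\ exists u, {subset cells h1 h2 P u <= cells h1 h2 I t}).
Proof.
elim: t s I => [|c t1 IH1 t2 IH2] [|d s1 s2] I.
- by move=> hP; left; split=> //; exists Leaf => Q; move: hP; rewrite !inE => /eqP->.
- by rewrite /= inE => /eqP->; left; split; [rewrite ?inE|exists (Node d s1 s2)].
- by rewrite /= inE => /eqP->; right; split; [rewrite ?inE|exists (Node c t1 t2)].
rewrite /= mem_cat => /orP[/IH1|/IH2] [] [hP [u hu]]; [left|right|left|right];
  rewrite !mem_cat hP ?orbT; split=> //; exists u => Q /hu; rewrite mem_cat => ->;
  by rewrite ?orbT.
Qed.

End ClosedEq.

(** * Grids over a relation that passes to halves in both directions *)

Section Grid.
Variables (T : eqType) (h1 h2 k1 k2 : T -> T) (G : T -> T -> Prop) (I0 J0 : T).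
Hypothesis Gh : forall I J, G I J -> G (h1 I) J /\ G (h2 I) J.
Hypothesis Gk : forall I J, G I J -> G I (k1 J) /\ G I (k2 J).
Hypothesis Gcross : forall I J,
  G (h1 I) J -> G (h2 I) J -> G I (k1 J) -> G I (k2 J) -> G I J.

Definition grid t s : Prop := forall I J,
  I \in cells h1 h2 I0 t -> J \in cells k1 k2 J0 s -> G I J.

(** The outer induction gives [G] on both halves of [I]; the inner one carries these along while
    descending in [s], so that [Gcross] finds all four halves it needs. *)
Lemma cross_cells I J t s : (forall P, P \in cells h1 h2 I t -> G P J) ->
  (forall Q, Q \in cells k1 k2 J s -> G I Q) -> G I J.
Proof.
elim: t I => [|c t1 IH1 t2 IH2] I hP hQ; first by apply: hP; rewrite inE.
have {}IH1 : G (h1 I) J.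
  by apply: IH1 => [P hP1|Q /hQ/Gh[]//]; apply: hP; rewrite /= mem_cat hP1.
have {}IH2 : G (h2 I) J.
  by apply: IH2 => [P hP2|Q /hQ/Gh[]//]; apply: hP; rewrite /= mem_cat hP2 orbT.
elim: s J IH1 IH2 hQ {hP} => [|d s1 IHs1 s2 IHs2] J G1 G2 hQ.
  by apply: hQ; rewrite inE.
have [[G11 G12] [G21 G22]] := (Gk G1, Gk G2).
apply: Gcross => //; [apply: IHs1|apply: IHs2] => // Q hQ'; apply: hQ;
  by rewrite /= mem_cat hQ' ?orbT.
Qed.

(** In the mixed cases [I] is a cell of one grid and [J] of the other, so each grid cuts [I] x [J]
    in one direction only; [cross_cells] merges the pieces. *)
Lemma grid_meet t s t' s' : grid t s -> grid t' s' -> grid (tree_meet t t') (tree_meet s s').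
Proof.
move=> g g' I J /meet_cells[] [hI [u hu]] /meet_cells[] [hJ [w hw]].
- exact: g.
- by apply: (@cross_cells I J u w) => P hP; [apply: g'; rewrite ?hu|apply: g; rewrite ?hw].
- by apply: (@cross_cells I J u w) => P hP; [apply: g; rewrite ?hu|apply: g'; rewrite ?hw].
- exact: g'.
Qed.

Lemma reduced_grid_meet t s t' s' : grid t s -> grid t' s' ->
  reduced_for h1 h2 I0 t (fun I => forall J, J \in cells k1 k2 J0 s -> G I J) ->
  t = tree_meet t t'.
Proof.
move=> g g' red; have gm := grid_meet g g'.
apply: (reduced_for_meet _ red) => [P HP|I hI].
  by split=> J /HP/Gh[].
apply: (@cells_meet_closed _ k1 k2 _ _ J0 s s') => [Q|J hJ]; first exact: Gk.
exact: gm.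
Qed.

(** Induction on the total number of leaves: while the grid is not reduced, some exposed caret can
    be removed. *)
Lemma exists_reduced_grid t s : injective h1 -> injective k1 -> grid t s ->
  exists t' s', [/\ grid t' s',
    reduced_for h1 h2 I0 t' (fun I => forall J, J \in cells k1 k2 J0 s' -> G I J),
    reduced_for k1 k2 J0 s' (fun J => forall I, I \in cells h1 h2 I0 t' -> G I J),
    forall q, all_shape q t -> all_shape q t' &
    forall q, all_shape q s -> all_shape q s'].
Proof.
move=> injh injk; have [n] := ubnP (nleaves t + nleaves s)%N.
elim: n t s => // n IH t s ltn g.
(* Injectivity identifies the merged cell [P] allowed by the failure of reducedness with the cell
   [P'] of the pruned tree. *)
have prune (k l : T -> T) (X Y X' Y' : seq T) (P P' : T) : injective k -> size X = size X' ->
    X ++ k P :: l P :: Y = X' ++ k P' :: l P' :: Y' -> [/\ X = X', P = P' & Y = Y'].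
  by move=> injk' sX /eqP; rewrite eqseq_cat // => /andP[/eqP-> /eqP[/injk'-> _ ->]].
case: (pselect (reduced_for h1 h2 I0 t
    (fun I => forall J, J \in cells k1 k2 J0 s -> G I J))) => [redt|].
  case: (pselect (reduced_for k1 k2 J0 s
      (fun J => forall I, I \in cells h1 h2 I0 t -> G I J))) => [reds|].
    by exists t, s.
  move=> /existsNP[X /existsNP[P /existsNP[Y /not_implyP[ex /not_implyP[eX /contrapT HP]]]]].
  have [X' [P' [Y' [s' [sX e1 e2 sh]]]]] := exposed_prune k1 k2 J0 ex.
  have [eqX eqP' eqY] := prune _ _ _ _ _ _ _ _ injk (esym sX) (etrans (esym eX) e1).
  have [||t'' [s'' [? ? ? ? sh'']]] := IH t s'.
  - rewrite -(size_cells k1 k2 J0 s') e2; move: ltn.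
    by rewrite -(size_cells k1 k2 J0 s) e1 !size_cat /= !addnS ltnS.
  - move=> I J hI; rewrite e2 mem_cat inE => hJ.
    have [/eqP->|nJ] := boolP (J == P'); first by rewrite -eqP'; apply: HP.
    apply: g => //; rewrite e1 mem_cat !inE.
    by move: hJ; rewrite (negPf nJ) /= => /orP[] ->; rewrite ?orbT.
  by exists t'', s''; split=> // q /sh; apply: sh''.
move=> /existsNP[X /existsNP[P /existsNP[Y /not_implyP[ex /not_implyP[eX /contrapT HP]]]]].
have [X' [P' [Y' [t' [sX e1 e2 sh]]]]] := exposed_prune h1 h2 I0 ex.
have [eqX eqP' eqY] := prune _ _ _ _ _ _ _ _ injh (esym sX) (etrans (esym eX) e1).
have [||t'' [s'' [? ? ? sh'' ?]]] := IH t' s.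
- rewrite -(size_cells h1 h2 I0 t') e2; move: ltn.
  by rewrite -(size_cells h1 h2 I0 t) e1 !size_cat /= !addnS !addSn ltnS.
- move=> I J; rewrite e2 mem_cat inE => hI hJ.
  have [/eqP->|nI] := boolP (I == P'); first by rewrite -eqP'; apply: HP.
  apply: g => //; rewrite e1 mem_cat !inE.
  by move: hI; rewrite (negPf nI) /= => /orP[] ->; rewrite ?orbT.
by exists t'', s''; split=> // q /sh; apply: sh''.
Qed.

End Grid.
End AbstractGrids.

(** * Affine maps onto basic dyadic rectangles *)

Section AffineToBasic.
Local Open Scope classical_set_scope.
Local Open Scope ring_scope.
Variable R : realType.
Implicit Types (d e : dyadic) (r s : drect) (t : tree) (x y u v : R) (f : R * R -> R * R).

Lemma lower_interval d : interval_of d (lower R d).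
Proof. by rewrite interval_ofE lexx ltrDl width_gt0. Qed.

(** An increasing affine bijection of half-open intervals matches left ends and scales the width by
    its slope, which determines it. *)
Lemma affine_dyadic_map d e u v : 0 < u ->
  (forall x, interval_of d x -> interval_of e (u * x + v)) ->
  (forall y, interval_of e y -> exists2 x, interval_of d x & y = u * x + v) ->
  forall x, u * x + v = dyadic_map d e x.
Proof.
move=> u0 into onto.
have d0 := width_gt0 R d; have e0 := width_gt0 R e.
have lowE : u * lower R d + v = lower R e.
  apply/eqP; rewrite eq_le; apply/andP; split; last first.
    by have := into _ (lower_interval d); rewrite interval_ofE => /andP[].
  have [x] := onto _ (lower_interval e); rewrite interval_ofE => /andP[h _] ->.
  by rewrite lerD2r ler_pM2l.
(* If the slope is too large, the point sent to the upper end of [e] lies in [d]; if too small, the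
   image of the upper end of [d] lies in [e] and has no preimage in [d]. *)
have uppE : u * width R d = width R e.
  apply/eqP; rewrite eq_le !leNgt; apply/andP; split; apply/negP => lt.
    have h : interval_of d (lower R d + width R e / u).
      rewrite interval_ofE lerDl divr_ge0 ?ltW //=.
      by rewrite ltrD2l ltr_pdivrMr // mulrC.
    have := into _ h; rewrite mulrDr addrAC lowE mulrCA divff ?lt0r_neq0 // mulr1.
    by rewrite interval_ofE ltxx andbF.
  have h : interval_of e (lower R e + u * width R d).
    by rewrite interval_ofE lerDl mulr_ge0 ?ltW //= ltrD2l.
  have [x] := onto _ h; rewrite interval_ofE -lowE => /andP[_ hx].
  rewrite addrAC -mulrDr => /addIr /mulfI; rewrite lt0r_neq0 // => /(_ isT) xE.
  by rewrite xE ltxx in hx.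
move=> x; rewrite dyadic_mapE -uppE -lowE mulfK ?lt0r_neq0 //.
by ring.
Qed.

Lemma dyadic_map_affine d e : exists (p : int) v, forall x : R,
  dyadic_map d e x = 2 ^ p * x + v.
Proof.
exists (d.1%:Z - e.1%:Z), (lower R e - lower R d * (width R e / width R d)) => x.
rewrite dyadic_mapE expfzDr ?pnatr_eq0 // -exprnN exprnP -exprnP.
rewrite -[(2 ^+ e.1)^-1]/(width R e) -[2 ^+ d.1]invrK -[(2 ^+ d.1)^-1]/(width R d).
by ring.
Qed.

Definition basic r : bool := (r.1.2 < 2 ^ r.1.1)%N && (r.2.2 < 2 ^ r.2.1)%N.

Definition dyadic_on f r : Prop :=
  exists2 s, basic s & forall z, rect_of r z -> f z = rect_map r s z.

(** The slopes are positive, so the image determines the map; the condition on the image becomes a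
    formula that restricts to subrectangles. *)
Lemma affine_to_basicP f r : affine_to_basic f (rect_of r) <-> dyadic_on f r.
Proof.
split=> [[[p [q [c [d fE]]]] [s [b1 b2 imE]]]|[s /andP[b1 b2] fE]].
  exists s; first by rewrite /basic b1.
  have into z : rect_of r z -> rect_of s (f z) by move=> rz; rewrite -imE; exists z.
  have onto z : rect_of s z -> exists2 z', rect_of r z' & f z' = z by rewrite -imE.
  (* Fixing the other coordinate at the lower end of its interval reduces the claim to one
     dimension. *)
  have E1 : forall x, 2 ^ p * x + c = dyadic_map r.1 s.1 x.
    apply: affine_dyadic_map => [|x hx|y hy]; first by rewrite exprz_gt0.
    - have hz : rect_of r (x, lower R r.2) by split=> //; apply: lower_interval.
      by have := into _ hz; rewrite fE // => -[].
    - have [|z hz] := onto (y, lower R s.2); first by split=> //; apply: lower_interval.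
      by rewrite fE // => -[<- _]; exists z.1 => //; case: hz.
  have E2 : forall x, 2 ^ q * x + d = dyadic_map r.2 s.2 x.
    apply: affine_dyadic_map => [|x hx|y hy]; first by rewrite exprz_gt0.
    - have hz : rect_of r (lower R r.1, x) by split=> //; apply: lower_interval.
      by have := into _ hz; rewrite fE // => -[].
    - have [|z hz] := onto (lower R s.1, y); first by split=> //; apply: lower_interval.
      by rewrite fE // => -[_ <-]; exists z.2 => //; case: hz.
  by move=> z rz; rewrite fE // /rect_map -E1 -E2.
have [p [c Ec]] := dyadic_map_affine r.1 s.1.
have [q [d Ed]] := dyadic_map_affine r.2 s.2.
split; first by exists p, q, c, d => z rz; rewrite fE // /rect_map Ec Ed.
exists s; split=> //; apply/seteqP; split=> z.
  by case=> z' rz' <-; rewrite fE //; case: rz' => ? ?; split; apply: dyadic_map_interval.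
case=> z1 z2; exists (rect_map s r z); first by split; apply: dyadic_map_interval.
rewrite fE; last by split; apply: dyadic_map_interval.
rewrite /rect_map /= !dyadic_map_comp.
have := maps_rects_id R [:: s] => -[/(_ z)h _].
by rewrite -/(rect_map s s z) -h.
Qed.

Lemma basic_child1 c r : basic r -> basic (child1 c r).
Proof.
by case: c; rewrite /basic /= expnS mul2n -?[X in (X < _)%N]/(_.*2.+1) ?ltn_double ?ltn_Sdouble //.
Qed.

Lemma basic_child2 c r : basic r -> basic (child2 c r).
Proof.
by case: c; rewrite /basic /= expnS mul2n -?[X in (X < _)%N]/(_.*2.+1) ?ltn_double ?ltn_Sdouble //.
Qed.

Lemma basic_leaves t r s : basic r -> s \in leaves_from r t -> basic s.
Proof.
elim: t r => [|c t1 IH1 t2 IH2] r br; first by rewrite inE => /eqP->.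
rewrite leaves_from_Node mem_cat => /orP[].
  exact/IH1/basic_child1.
exact/IH2/basic_child2.
Qed.

Lemma dyadic_on_children f c r : dyadic_on f r ->
  dyadic_on f (child1 c r) /\ dyadic_on f (child2 c r).
Proof.
case=> s bs fE; split.
  exists (child1 c s); first exact: basic_child1.
  by move=> z rz; rewrite rect_map_child1 fE //; apply/(rect_of_children c); left.
exists (child2 c s); first exact: basic_child2.
by move=> z rz; rewrite rect_map_child2 fE //; apply/(rect_of_children c); right.
Qed.

Lemma eq_dyadic_map d d' e e' d0 :
  (forall x, interval_of d0 x -> dyadic_map d e x = dyadic_map d' e' x) ->
  forall x : R, dyadic_map d e x = dyadic_map d' e' x.
Proof.
move=> h; have [p [c Ec]] := dyadic_map_affine d e.
have [q [b Eb]] := dyadic_map_affine d' e'.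
(* The midpoint is the second point of comparison; the upper end is not in the interval. *)
have w0 : interval_of d0 (lower R d0 + width R d0 / 2).
  by rewrite -lower_hi_half; apply/interval_halves; right; apply: lower_interval.
have := h _ w0; have := h _ (lower_interval d0); rewrite !Ec !Eb => hl hw.
have : (2 ^ p - 2 ^ q) * (width R d0 / 2) = 0 by lra.
have wn0 : width R d0 / 2 != 0 by rewrite mulf_neq0 ?lt0r_neq0 ?width_gt0 ?invr_gt0.
move=> /eqP; rewrite mulf_eq0 (negPf wn0) orbF subr_eq0 => /eqP pq x.
by rewrite Ec Eb; move: hl; rewrite pq => /addrI ->.
Qed.

(** Each half shares a quarter with each half of the other direction, and a coordinate map is
    determined by its values on the side of a quarter. So top and bottom agree in the first
    coordinate, left and right in the second. *)
Lemma dyadic_on_cross f (I J : dyadic) :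
  dyadic_on f (lo_half I, J) -> dyadic_on f (hi_half I, J) ->
  dyadic_on f (I, hi_half J) -> dyadic_on f (I, lo_half J) -> dyadic_on f (I, J).
Proof.
move=> [[a b] /andP[_ bb] E1] [[a2 b2] _ E2] [[a3 b3] /andP[ba _] E3] [[a4 b4] _ E4].
have sub d : @interval_of R (lo_half d) `<=` @interval_of R d
    /\ @interval_of R (hi_half d) `<=` @interval_of R d.
  by split=> x hx; apply/interval_halves; [left|right].
have [[lI hI] [lJ hJ]] := (sub I, sub J).
have A3 (x : R) : dyadic_map I a3 x = dyadic_map (lo_half I) a x.
  apply: (eq_dyadic_map (d0 := lo_half I)) => {}x hx.
  have hz := lower_interval (hi_half J).
  have := E1 (x, _) (conj hx (hJ _ hz)).
  by rewrite (E3 (x, _) (conj (lI _ hx) hz)) => -[].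
have A4 (x : R) : dyadic_map I a4 x = dyadic_map (lo_half I) a x.
  apply: (eq_dyadic_map (d0 := lo_half I)) => {}x hx.
  have hz := lower_interval (lo_half J).
  have := E1 (x, _) (conj hx (lJ _ hz)).
  by rewrite (E4 (x, _) (conj (lI _ hx) hz)) => -[].
have B1 (y : R) : dyadic_map J b y = dyadic_map (hi_half J) b3 y.
  apply: (eq_dyadic_map (d0 := hi_half J)) => {}y hy.
  have hz := lower_interval (lo_half I).
  have := E3 (_, y) (conj (lI _ hz) hy).
  by rewrite (E1 (_, y) (conj hz (hJ _ hy))) => -[].
have B2 (y : R) : dyadic_map J b2 y = dyadic_map (hi_half J) b3 y.
  apply: (eq_dyadic_map (d0 := hi_half J)) => {}y hy.
  have hz := lower_interval (hi_half I).
  have := E3 (_, y) (conj (hI _ hz) hy).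
  by rewrite (E2 (_, y) (conj hz (hJ _ hy))) => -[].
(* The top half spans [I] and gives the first side of the target; the left half spans [J] and gives
   the second. *)
exists (a3, b); first by rewrite /basic ba.
move=> [x y] [/= hx hy]; rewrite [f _]surjective_pairing /rect_map; congr (_, _) => /=.
  have /interval_halves[hy'|hy'] := hy.
    by rewrite A3 -A4 (E4 (x, y) (conj hx hy')).
  by rewrite (E3 (x, y) (conj hx hy')).
have /interval_halves[hx'|hx'] := hx.
  by rewrite (E1 (x, y) (conj hx' hy)).
by rewrite B1 -B2 (E2 (x, y) (conj hx' hy)).
Qed.

End AffineToBasic.

(** * Grid diagrams of a map *)

Section GridDiagrams.
Local Open Scope classical_set_scope.
Local Open Scope ring_scope.
Variables (R : realType) (f : R * R -> R * R).
Implicit Types (I J : dyadic) (r : drect) (S t s Tv Th : tree).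

Let G I J : Prop := dyadic_on f (I, J).
Let vcells := cells lo_half hi_half.
(* The first child of a square caret is the top half. *)
Let hcells := cells hi_half lo_half.

Let Gh I J : G I J -> G (lo_half I) J /\ G (hi_half I) J.
Proof. exact: (@dyadic_on_children R f Tri (I, J)). Qed.

Let Gk I J : G I J -> G I (hi_half J) /\ G I (lo_half J).
Proof. exact: (@dyadic_on_children R f Sq (I, J)). Qed.

Lemma leaves_only_tri r t : only_tri t ->
  leaves_from r t = [seq (d, r.2) | d <- vcells r.1 t].
Proof.
elim: t r => [|c t1 IH1 t2 IH2] r /=; first by case: r.
by case=> -> o1 o2; rewrite IH1 // IH2 // map_cat.
Qed.

Lemma leaves_only_sq r t : only_sq t ->
  leaves_from r t = [seq (r.1, d) | d <- hcells r.2 t].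
Proof.
elim: t r => [|c t1 IH1 t2 IH2] r /=; first by case: r.
by case=> -> o1 o2; rewrite IH1 // IH2 // map_cat.
Qed.

Let Igrid := vcells unit_rect.1.
Let Jgrid := hcells unit_rect.2.

Lemma vintervalE t i : only_tri t ->
  @vinterval R t i = interval_of (nth unit_rect.1 (Igrid t) i).
Proof.
move=> ot; rewrite /vinterval /leaf_rect /leaves leaves_only_tri //.
rewrite -[unit_rect in nth unit_rect]/((fun d : dyadic => (d, unit_rect.2)) unit_rect.1).
by rewrite nth_map_default.
Qed.

Lemma hintervalE t j : only_sq t ->
  @hinterval R t j = interval_of (nth unit_rect.2 (Jgrid t) j).
Proof.
move=> ot; rewrite /hinterval /leaf_rect /leaves leaves_only_sq //.
rewrite -[unit_rect in nth unit_rect]/((fun d : dyadic => (unit_rect.1, d)) unit_rect.2).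
by rewrite nth_map_default.
Qed.

Let is_grid := grid lo_half hi_half hi_half lo_half G unit_rect.1 unit_rect.2.

Lemma grid_diagramP Tv Th :
  grid_diagram f Tv Th <-> [/\ only_tri Tv, only_sq Th & is_grid Tv Th].
Proof.
split=> [] [ov oh g]; split=> //.
  move=> I J /(nthP unit_rect.1)[i + <-] /(nthP unit_rect.2)[j + <-].
  rewrite !size_cells => lti ltj; apply/affine_to_basicP.
  by have := g i j lti ltj; rewrite vintervalE // hintervalE.
move=> i j lti ltj; rewrite vintervalE // hintervalE //.
apply/(affine_to_basicP f (_, _))/g; apply: mem_nth; by rewrite size_cells.
Qed.

Let vreduced Tv Th := reduced_for lo_half hi_half unit_rect.1 Tv
  (fun I => forall J, J \in Jgrid Th -> G I J).
Let hreduced Tv Th := reduced_for hi_half lo_half unit_rect.2 Th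
  (fun J => forall I, I \in Igrid Tv -> G I J).

Lemma interval_halvesU I :
  @interval_of R (lo_half I) `|` @interval_of R (hi_half I) = @interval_of R I.
Proof. by apply/seteqP; split=> x; rewrite interval_halves. Qed.

Lemma reduced_grid_diagramP Tv Th : reduced_grid_diagram f Tv Th <->
  [/\ only_tri Tv, only_sq Th, is_grid Tv Th, vreduced Tv Th & hreduced Tv Th].
Proof.
have vU X P Y : only_tri Tv -> Igrid Tv = X ++ lo_half P :: hi_half P :: Y ->
    @vinterval R Tv (size X) `|` @vinterval R Tv (size X).+1 = interval_of P.
  move=> ov eqX; rewrite !vintervalE // eqX nth_cat_size // -cat_rcons nth_cat_size ?size_rcons //.
  exact: interval_halvesU.
have hU X P Y : only_sq Th -> Jgrid Th = X ++ hi_half P :: lo_half P :: Y ->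
    @hinterval R Th (size X) `|` @hinterval R Th (size X).+1 = interval_of P.
  move=> oh eqX; rewrite !hintervalE // eqX nth_cat_size // -cat_rcons nth_cat_size ?size_rcons //.
  (* [Jgrid] lists the top half first, hence the exchange. *)
  by rewrite setUC; apply: interval_halvesU.
split=> [[/grid_diagramP[ov oh g] rv rh]|[ov oh g rv rh]].
  split=> // [X P Y ex eqX HP|X P Y ex eqX HP].
    have [j ltj []] := rv _ ex; rewrite (vU _ _ _ ov eqX) hintervalE //.
    by apply/(affine_to_basicP f (_, _))/HP/mem_nth; rewrite size_cells.
  have [i lti []] := rh _ ex; rewrite (hU _ _ _ oh eqX) vintervalE //.
  by apply/(affine_to_basicP f (_, _))/HP/mem_nth; rewrite size_cells.
split; first exact/grid_diagramP.
  move=> i ex; have [X [P [Y [t' [sX eqX _ _]]]]] := exposed_prune lo_half hi_half unit_rect.1 ex.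
  subst i; have /existsNP[J /not_implyP[/(nthP unit_rect.2)[j ltj <-] nG]] := rv _ _ _ ex eqX.
  rewrite size_cells in ltj; exists j => //.
  by rewrite (vU _ _ _ ov eqX) hintervalE // => /(affine_to_basicP f (_, _)).
move=> i ex; have [X [P [Y [t' [sX eqX _ _]]]]] := exposed_prune hi_half lo_half unit_rect.2 ex.
subst i; have /existsNP[J /not_implyP[/(nthP unit_rect.1)[j ltj <-] nG]] := rh _ _ _ ex eqX.
rewrite size_cells in ltj; exists j => //.
by rewrite (hU _ _ _ oh eqX) vintervalE // => /(affine_to_basicP f (_, _)).
Qed.

Lemma reduced_grid_diagram_unique Tv Th Tv' Th' :
  reduced_grid_diagram f Tv Th -> reduced_grid_diagram f Tv' Th' ->
  Tv = Tv' /\ Th = Th'.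
Proof.
move=> /reduced_grid_diagramP[ov oh g rv rh] /reduced_grid_diagramP[ov' oh' g' rv' rh'].
have cross : forall I J, G (lo_half I) J -> G (hi_half I) J ->
    G I (hi_half J) -> G I (lo_half J) -> G I J by move=> I J; apply: dyadic_on_cross.
have crossT J I : G I (hi_half J) -> G I (lo_half J) ->
    G (lo_half I) J -> G (hi_half I) J -> G I J by move=> ? ? ? ?; apply: cross.
(* [reduced_grid_meet] compares the first trees of two grids; the horizontal trees become first
   under the transposed relation. *)
pose GT J I := G I J.
have gT : grid hi_half lo_half lo_half hi_half GT unit_rect.2 unit_rect.1 Th Tv.
  by move=> J I hJ hI; apply: g.
have gT' : grid hi_half lo_half lo_half hi_half GT unit_rect.2 unit_rect.1 Th' Tv'.
  by move=> J I hJ hI; apply: g'.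
have Gh' J I : GT J I -> GT (hi_half J) I /\ GT (lo_half J) I by apply: Gk.
have Gk' J I : GT J I -> GT J (lo_half I) /\ GT J (hi_half I) by apply: Gh.
split.
  rewrite (reduced_grid_meet Gh Gk cross g g' rv) (tree_meetC ov ov').
  by rewrite -(reduced_grid_meet Gh Gk cross g' g rv').
rewrite (reduced_grid_meet Gh' Gk' crossT gT gT' rh) (tree_meetC oh oh').
by rewrite -(reduced_grid_meet Gh' Gk' crossT gT' gT rh').
Qed.

Fixpoint full_tree c k : tree :=
  if k is k'.+1 then Node c (full_tree c k') (full_tree c k') else Leaf.

Lemma all_shape_full c k : all_shape (fun d => d = c) (full_tree c k).
Proof. by elim: k. Qed.

(** Each caret of [S] uses up one level of the full tree in its own direction, and [nleaves S]
    exceeds the depth of [S]. Below a leaf of [S], [dyadic_on] passes to halves. *)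
Lemma full_grid S I J k l : (forall r, r \in leaves_from (I, J) S -> dyadic_on f r) ->
  (nleaves S <= k)%N -> (nleaves S <= l)%N ->
  grid lo_half hi_half hi_half lo_half G I J (full_tree Tri k) (full_tree Sq l).
Proof.
elim: S I J k l => [|c S1 IH1 S2 IH2] I J k l hS.
  move=> _ _ I' J' hI hJ; have GIJ : G I J by apply: hS; rewrite inE.
  apply: (@cells_closed _ lo_half hi_half (fun I => G I J') _ I _ _ I' hI) => [P|].
    exact: Gh.
  apply: (@cells_closed _ hi_half lo_half (G I) _ J _ _ J' hJ) => // P; exact: Gk.
have := nleaves_gt0 S1; have := nleaves_gt0 S2; rewrite nleaves_Node => n2 n1 lek lel.
have hS1 r : r \in leaves_from (child1 c (I, J)) S1 -> dyadic_on f r.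
  by move=> hr; apply: hS; rewrite leaves_from_Node mem_cat hr.
have hS2 r : r \in leaves_from (child2 c (I, J)) S2 -> dyadic_on f r.
  by move=> hr; apply: hS; rewrite leaves_from_Node mem_cat hr orbT.
case: c hS1 hS2 {hS} => hS1 hS2.
  case: k lek => [|k] lek; first by lia.
  move=> I' J'; rewrite [full_tree Tri k.+1]/= /= mem_cat => /orP[] hI hJ.
    by apply: (IH1 _ _ k l hS1) => //; lia.
  by apply: (IH2 _ _ k l hS2) => //; lia.
case: l lel => [|l] lel; first by lia.
move=> I' J' hI; rewrite /= mem_cat => /orP[] hJ.
  by apply: (IH1 _ _ k l hS1) => //; lia.
by apply: (IH2 _ _ k l hS2) => //; lia.
Qed.

Lemma reduced_grid_diagram_exists : in_2V f ->
  exists Tv Th, reduced_grid_diagram f Tv Th.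
Proof.
case=> _ [S [T [ts [permT sizeT hS]]]].
have good r : r \in leaves S -> dyadic_on f r.
  move=> /(nthP unit_rect)[i lti <-]; apply/affine_to_basicP.
  have [aff im] := hS i lti; split=> //; exists (nth unit_rect ts i).
  have : basic (nth unit_rect ts i).
    apply: (@basic_leaves T unit_rect) => //.
    by rewrite -(perm_mem permT) mem_nth // sizeT.
  by case/andP.
have g := full_grid good (leqnn _) (leqnn _).
have dinj : injective double by exact: double_inj.
have lo_inj : injective lo_half by move=> [a b] [c d] [-> /dinj->].
have hi_inj : injective hi_half by move=> [a b] [c d] [-> /dinj->].
have [Tv [Th [g' rv rh sv sh]]] := exists_reduced_grid lo_inj hi_inj g.
exists Tv, Th; apply/reduced_grid_diagramP; split=> //.
  by apply/sv/all_shape_full.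
by apply/sh/all_shape_full.
Qed.

End GridDiagrams.

Theorem theorem5p2 (R : realType) (f : R * R -> R * R) (hf : in_2V f) :
  (exists! w : word,
     exists Tv Th : tree, reduced_grid_diagram f Tv Th /\ w = grid_word Tv Th)
  /\
  (forall (Tv Th : tree) (n m : nat),
     reduced_grid_diagram f Tv Th ->
     nleaves Tv = n.+1 -> nleaves Th = m.+1 ->
     let a := leaf_exponent Tv in
     let b := leaf_exponent Th in
     let b' := full_leaf_exponent Th in
     (* (1) *)
     corresponds R (A_word a n) Tv
     /\
     (* (2): the two words by themselves; the exponents; and the two words as
        the contribution of a copy of Th hung from leaf j of Tv, on the spine
        (j = n) or not (j < n) *)
     [/\ corresponds R (B_word 0 b m) (tri_spine Th),
         corresponds R (B_word 0 b' m) (Node Tri Th Leaf),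
         forall p, (p <= m)%N -> b' p = b p \/ b' p = (b p).+1,
         corresponds R
           (C_word (spine_size Tv) (spine_size Th)
              ++ A_word a n ++ B_word n b m)
           (graft Tv n Th)
       & forall j, (j < n)%N ->
           corresponds R (A_word a n ++ B_word j b' m) (graft Tv j Th)]
     /\
     (* (3) *)
     grid_word Tv Th =
       C_word (spine_size Tv) (spine_size Th)
       ++ flatten [seq nseq (a j) (A_ (m.+1 * j)) ++ B_word (m.+1 * j) b' m
                  | j <- iota 0 n]
       ++ nseq (a n) (A_ (m.+1 * n)) ++ B_word (m.+1 * n) b m
     /\ corresponds R (grid_word Tv Th) (hang Tv Th)).
Proof.
split.
  have [Tv [Th red]] := reduced_grid_diagram_exists hf.
  exists (grid_word Tv Th); split; first by exists Tv, Th.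
  move=> w [Tv' [Th' [red' ->]]].
  by have [-> ->] := reduced_grid_diagram_unique red red'.
move=> Tv Th n m [[ov oh _] _ _] eqn eqm a b b'.
have eqn1 : (nleaves Tv).-1 = n by rewrite eqn.
rewrite /a /b /b'; do !split.
- by rewrite A_wordE //; apply/realizes_corresponds/tree_word_realizes.
- rewrite B_word_off_spine // -tree_word_tri_spine.
  exact/realizes_corresponds/tree_word_realizes.
- rewrite B_word_inner //.
  (* A triangular root with [Th] on its left puts all of [Th] off the spine at the cost of no
     letter. *)
  have -> : inner_word 0 Th = tree_word (Node Tri Th Leaf) by rewrite /tree_word /= cats0.
  exact/realizes_corresponds/tree_word_realizes.
- by move=> p _; apply: full_leaf_exponent_spine.
(* Hung from the last leaf, [Th] prolongs the spine of [Tv]; its [C_] letters start at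
   [spine_size Tv] and come before all off-spine letters. *)
- have -> : C_word (spine_size Tv) (spine_size Th) ++ A_word (leaf_exponent Tv) n
      ++ B_word n (leaf_exponent Th) m = tree_word (graft Tv n Th).
    rewrite A_wordE // B_word_off_spine // /tree_word -eqn1.
    rewrite spine_word_graft off_spine_word_graft.
    by rewrite !(spine_word_tri _ ov) (spine_word_sq _ oh).
  exact/realizes_corresponds/tree_word_realizes.
- move=> j ltj; rewrite A_wordE // B_word_inner //.
  by apply/realizes_corresponds/tree_word_graft; rewrite eqn.
- by rewrite /grid_word eqn eqm.
- by rewrite grid_wordE //; apply/realizes_corresponds/tree_word_realizes.
Qed.
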